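(* Let $\mathcal M$ be a Hesse Monge--Ampère system on a contact manifold of dimension $2n+1$, i.e. a Monge--Ampère system with a flat Lagrangian pair $(E_1,E_2)$, generated by an $n$-form $\omega=\omega_1-\omega_2$ enjoying the bi-decomposing condition. Then $\mathcal M$ is locally isomorphic to a Monge--Ampère system $\mathcal M'$ on an open subset $U\subset\mathbf R^{2n+1}$ with the standard Lagrangian pair $(E_1^{\rm st},E_2^{\rm st})$ which is locally generated by an $n$-form of type $$F(x_1,\dots,x_n,z,p_1,\dots,p_n)\,dx_1\wedge\cdots\wedge dx_n-dp_1\wedge\cdots\wedge dp_n$$ for a non-vanishing function $F$ on $U$. In particular, there exists a system of local Darboux coordinates $(x_1,\dots,x_n,z,p_1,\dots,p_n)$ in some neighborhood of each point such that $\mathcal M$ is represented by a Hesse Monge--Ampère equation of the form $$\mathrm{Hess}(z)=F(x_1,\dots,x_n,z,p_1,\dots,p_n)\qquad(F\ne0).$$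
   Context: All objects are $C^\infty$. A contact structure $D$ on a manifold $M$ of dimension $2n+1$ is a subbundle of $TM$ of codimension one, locally $D=\{\theta=0\}$ for a $1$-form $\theta$ (a contact form) such that $d\theta|_D$ is non-degenerate. A Lagrangian pair $(E_1,E_2)$ is a pair of rank-$n$ subbundles of $D$, each isotropic for $d\theta$, with $D=E_1\oplus E_2$. A Monge--Ampère system $\mathcal M$ on $(M,D)$ is an exterior differential system which is locally the ideal $\langle\theta,d\theta,\omega\rangle$ generated algebraically by a contact form $\theta$, $d\theta$ and an $n$-form $\omega$ (a local generator). Here ''with Lagrangian pair $(E_1,E_2)$'' means that around each point there is a local generator $\omega=\omega_1-\omega_2$ satisfying the bi-decomposing condition: $i_u\omega_1=0$ for $u\in E_2$, $i_v\omega_2=0$ for $v\in E_1$, $\omega_1|_{E_1}$ is a volume form on $E_1$, $\omega_2|_{E_2}$ is a volume form on $E_2$. An isomorphism of Monge--Ampère systems is a diffeomorphism $\Phi$ with $\Phi_*D=D'$ and $\Phi^*\mathcal M'=\mathcal M$. The standard Lagrangian pair on $\mathbf R^{2n+1}$ with contact structure $D_{\rm st}=\{\theta_{\rm st}=0\}$, $\theta_{\rm st}=dz-\sum p_idx_i$, is $E_1^{\rm st}=\{v\in D_{\rm st}:dp_1(v)=\dots=dp_n(v)=0\}$, $E_2^{\rm st}=\{u\in D_{\rm st}:dx_1(u)=\dots=dx_n(u)=0\}$. A Lagrangian pair is flat if it is locally contactomorphic to $(E_1^{\rm st},E_2^{\rm st})$ on $(\mathbf R^{2n+1},D_{\rm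 st})$. $\mathrm{Hess}(z)=\det(\partial^2z/\partial x_i\partial x_j)$ for a function $z=z(x_1,\dots,x_n)$, with $p_i=\partial z/\partial x_i$; that $\mathcal M$ is represented by $\mathrm{Hess}(z)=F$ means that in these coordinates, in which $D=\{dz-\sum p_idx_i=0\}$, $\mathcal M$ is generated by $dz-\sum p_idx_i$, its exterior derivative and $F\,dx_1\wedge\cdots\wedge dx_n-dp_1\wedge\cdots\wedge dp_n$. *)

(* Defs.v *)
From HB Require Import structures.
From mathcomp Require Import all_boot all_order all_fingroup all_algebra.
From mathcomp Require Import all_classical all_reals all_analysis.
Set Implicit Arguments.
Unset Strict Implicit.
Unset Printing Implicit Defensive.
Import Order.TTheory GRing.Theory Num.Theory.
Import numFieldNormedType.Exports.
Local Open Scope classical_set_scope.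
Local Open Scope ring_scope.

(* C^oo on [O] (meant for [O] open): every iterated directional derivative
   is (Frechet) differentiable at every point of [O]. *)
Definition smooth_on (R : realType) (V W : normedModType R)
    (O : set V) (f : V -> W) : Prop :=
  forall (s : seq V) (y : V), O y ->
    differentiable (foldr (fun v (g : V -> W) => 'D_v g) f s) y.

Lemma rV_second_countable (R : realType) (m : nat) :
  @second_countable 'rV[R]_m.
Proof.
pose e (t : 'rV[rat]_m * nat) : set 'rV[R]_m :=
  ball (map_mx ratr t.1 : 'rV[R]_m) t.2.+1%:R^-1.
exists (range e).
  exact: card_le_trans (card_image_le _ _) (countableP _).
split=> [_ [t _ <-]|x A /nbhs_ballP[r /= r0 rA]]; first exact: ball_open.
have [k _ kr] : exists2 k : nat, True & k.+1%:R^-1 < r / 2 :> R.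
  have [|k Hk] := @ltr_add_invr R 0 (r / 2); first exact: divr_gt0.
  by exists k => //; rewrite add0r in Hk.
have k0 : 0 < (k.+1%:R^-1 : R) by rewrite invr_gt0 ltr0n.
have qP (i : 'I_1) (j : 'I_m) : exists q : rat, ball (ratr q : R) k.+1%:R^-1 (x i j).
  have [|q] := @rat_in_itvoo R (x i j - k.+1%:R^-1) (x i j + k.+1%:R^-1).
    by rewrite ltrBlDr -addrA ltrDl addr_gt0.
  by rewrite in_itv /= => q_in; exists q; rewrite /ball /= ltr_distl.
pose q := \matrix_(i, j) projT1 (cid (qP i j)).
have xq : ball (map_mx ratr q : 'rV[R]_m) k.+1%:R^-1 x.
  by split=> // i j; rewrite !mxE; exact: projT2 (cid (qP i j)).
exists (e (q, k)); first by split; first by exists (q, k).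
move=> y /= qy; apply: rA; rewrite (splitr r).
apply: (@ball_triangle _ _ (map_mx ratr q : 'rV[R]_m)).
  by apply: le_ball (ltW kr) _ _; exact: ball_sym.
exact: le_ball (ltW kr) _ qy.
Qed.

(* A C^oo manifold of dimension [m], given by an indexed atlas: [chart i] is a
   homeomorphism from the open set [dom i] onto an open subset of R^m, with
   inverse [param i]; both are total functions with irrelevant values elsewhere. *)
Record manifold (R : realType) (m : nat) := Manifold {
  carrier :> topologicalType ;
  idx : Type ;
  dom : idx -> set carrier ;
  chart : idx -> carrier -> 'rV[R]_m ;
  param : idx -> 'rV[R]_m -> carrier ;
  _ : hausdorff_space carrier ;
  _ : @second_countable carrier ;
  _ : forall p, exists i, dom i p ;
  _ : forall i, open (dom i) ;
  _ : forall i, open (chart i @` dom i) ;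
  _ : forall i p, dom i p -> param i (chart i p) = p ;
  _ : forall i p, dom i p -> {for p, continuous (chart i)} ;
  _ : forall i y, (chart i @` dom i) y -> {for y, continuous (param i)} ;
  _ : forall i j,
        smooth_on (chart i @` (dom i `&` dom j)) (chart j \o param i) }.

Lemma smooth_on_id (R : realType) (V : normedModType R) (O : set V) :
  smooth_on O (@idfun V).
Proof.
move=> s y _.
set g := foldr _ _ _.
have [->|[c ->]] : g = idfun \/ exists c : V, g = cst c.
- rewrite {}/g; elim: s => [|v s /= [->|[c ->]]]; first by left.
    by right; exists v; apply/funext => z; rewrite derive_id.
  by right; exists 0; apply/funext => z; rewrite derive_cst.
- by apply: (@linear_differentiable _ _ _ idfun) => z; exact: cvg_id.
- exact: differentiable_cst.
Qed.

(* R^m with its standard structure, given by the single identity chart. *)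
Definition euclid (R : realType) (m : nat) : manifold R m.
Proof.
refine (@Manifold R m 'rV[R]_m unit (fun _ => setT) (fun _ => idfun)
  (fun _ => idfun) _ _ _ _ _ _ _ _ _).
- exact: norm_hausdorff.
- exact: rV_second_countable.
- by move=> p; exists tt.
- by move=> _; exact: openT.
- by move=> _; rewrite image_id; exact: openT.
- by [].
- by move=> _ p _; exact: cvg_id.
- by move=> _ p _; exact: cvg_id.
- by move=> _ _; exact: smooth_on_id.
Defined.

Section Geometry.
Variables (R : realType) (m : nat).
Implicit Types (M : manifold R m).

(* Tensorial objects on [M] are given by their local expressions in all the
   charts: [E i y v] says that the vector with components [v] at the point
   [param i y] belongs to [E]; [alpha i y v] is the value at that point of the
   form [alpha] on the [k] vectors whose components are the rows of [v].
   Invariance under coordinate change is part of [is_form], [is_subbundle]. *)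
Definition plane_field M := idx M -> 'rV[R]_m -> 'rV[R]_m -> Prop.
Definition mform M k := idx M -> 'rV[R]_m -> 'M[R]_(k, m) -> R.

Section Maps.
Variables (M M' : manifold R m) (N : set M) (Phi : M -> M').

Definition local_rep (i : idx M) (j : idx M') : 'rV[R]_m -> 'rV[R]_m :=
  chart j \o Phi \o param i.

Definition smooth_map : Prop :=
  (forall p, N p -> {for p, continuous Phi}) /\
  (forall i j, smooth_on (chart i @` (N `&` dom i `&` (Phi @^-1` dom j)))
                 (local_rep i j)).

(* [beta = Phi^* alpha] on [N] *)
Definition is_pullback k (alpha : mform M' k) (beta : mform M k) : Prop :=
  forall p i j, N p -> dom i p -> dom j (Phi p) -> forall v : 'M[R]_(k, m),
    beta i (chart i p) v =
    alpha j (chart j (Phi p))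
      (\matrix_(a < k) ('d (local_rep i j) (chart i p) (row a v))).

(* [Phi_* E = E'] on [N], for [Phi] a local diffeomorphism on [N] *)
Definition pushes_to (E : plane_field M) (E' : plane_field M') : Prop :=
  forall p i j, N p -> dom i p -> dom j (Phi p) -> forall v : 'rV[R]_m,
    E i (chart i p) v <->
    E' j (chart j (Phi p)) ('d (local_rep i j) (chart i p) v).

End Maps.

Definition diffeo (M M' : manifold R m) (N : set M) (U : set M')
    (Phi : M -> M') (Psi : M' -> M) : Prop :=
  [/\ open N /\ open U, smooth_map N Phi, smooth_map U Psi,
      forall p, N p -> U (Phi p) /\ Psi (Phi p) = p
    & forall q, U q -> N (Psi q) /\ Phi (Psi q) = q].

Section OnManifold.
Variable M : manifold R m.

Definition is_subbundle (N : set M) (r : nat) (E : plane_field M) : Prop :=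
  pushes_to N idfun E E /\
  forall p i, N p -> dom i p ->
    exists (W : set M) (X : 'rV[R]_m -> 'M[R]_(r, m)),
      [/\ open W, W p, W `<=` N `&` dom i, smooth_on (chart i @` W) X
        & forall q, W q -> row_free (X (chart i q)) /\
            forall v, E i (chart i q) v <-> (v <= X (chart i q))%MS].

Definition alternating_multilinear k (phi : 'M[R]_(k, m) -> R) : Prop :=
  (forall (A B C : 'M[R]_(k, m)) (a : 'I_k) (b c : R),
     row a A = b *: row a B + c *: row a C ->
     row' a B = row' a A -> row' a C = row' a A ->
     phi A = b * phi B + c * phi C) /\
  (forall (A : 'M[R]_(k, m)) (a b : 'I_k),
     a != b -> row a A = row b A -> phi A = 0).

(* smooth differential [k]-forms on the open set [N] *)
Record is_form (N : set M) k (alpha : mform M k) : Prop := IsForm {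
  form_alternating : forall p i, N p -> dom i p ->
    alternating_multilinear (alpha i (chart i p)) ;
  form_smooth : forall i v,
    smooth_on (chart i @` (N `&` dom i)) (fun y => alpha i y v : R^o) ;
  form_compatible : is_pullback N idfun alpha alpha }.

Definition form_near (p : M) k (alpha : mform M k) : Prop :=
  exists W : set M, [/\ open W, W p & is_form W alpha].

Definition form_eq_on (N : set M) k (alpha beta : mform M k) : Prop :=
  forall p i, N p -> dom i p ->
    forall v, alpha i (chart i p) v = beta i (chart i p) v.

Definition form_eq_near (p : M) k (alpha beta : mform M k) : Prop :=
  exists W : set M, [/\ open W, W p & form_eq_on W alpha beta].

Definition mform0 k : mform M k := fun _ _ _ => 0.
Definition mform1 : mform M 0 := fun _ _ _ => 1.
Definition addf k (alpha beta : mform M k) : mform M k :=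
  fun i y v => alpha i y v + beta i y v.
Definition subf k (alpha beta : mform M k) : mform M k :=
  fun i y v => alpha i y v - beta i y v.

Definition wedge k l (alpha : mform M k) (beta : mform M l) : mform M (k + l) :=
  fun i y v => ((k`! * l`!)%N%:R)^-1 *
    \sum_(s : 'S_(k + l)) (-1) ^+ s *
      (alpha i y (usubmx (row_perm s v)) * beta i y (dsubmx (row_perm s v))).

Fixpoint wedges k : ('I_k -> mform M 1) -> mform M k :=
  match k with
  | 0%N => fun _ => mform1
  | k'.+1 => fun a => wedge (a ord0) (wedges (fun b => a (lift ord0 b)))
  end.

(* d alpha (v_0, .., v_k) = \sum_a (-1)^a D_{v_a} (alpha (.., ^v_a, ..)) *)
Definition extd k (alpha : mform M k) : mform M k.+1 :=
  fun i y v => \sum_(a < k.+1) (-1) ^+ a *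
    'D_(row a v) (fun y' => alpha i y' (row' a v) : R^o) y.

(* Homogeneous ideals of the graded algebra of germs at [p] of differential
   forms; [J k] is the set of (representatives of) germs of degree [k] in J. *)
Record is_ideal (p : M) (J : forall k, mform M k -> Prop) : Prop := IsIdeal {
  ideal_form : forall k (alpha : mform M k), J k alpha -> form_near p alpha ;
  ideal_germ : forall k (alpha beta : mform M k),
    form_eq_near p alpha beta -> J k alpha -> J k beta ;
  ideal_0 : forall k, J k (@mform0 k) ;
  ideal_add : forall k (alpha beta : mform M k),
    J k alpha -> J k beta -> J k (addf alpha beta) ;
  ideal_wedgel : forall k l (beta : mform M k) (alpha : mform M l),
    form_near p beta -> J l alpha -> J (k + l)%N (wedge beta alpha) ;
  ideal_wedger : forall k l (alpha : mform M k) (beta : mform M l),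
    form_near p beta -> J k alpha -> J (k + l)%N (wedge alpha beta) }.

(* A subsheaf of the sheaf of germs of forms, given by its stalks: [I p k] is
   the degree [k] part of the stalk at [p]. *)
Definition form_sheaf := M -> forall k, mform M k -> Prop.

(* Exterior differential systems on the open set [N]: sheaves of homogeneous
   ideals closed under d.  [eds_open] makes the family of stalks a subsheaf. *)
Record is_EDS (N : set M) (I : form_sheaf) : Prop := IsEDS {
  eds_ideal : forall p, N p -> is_ideal p (I p) ;
  eds_extd : forall p k (alpha : mform M k),
    N p -> I p k alpha -> I p k.+1 (extd alpha) ;
  eds_open : forall p k (alpha : mform M k), N p -> I p k alpha ->
    exists W : set M, [/\ open W, W p & forall q, W q -> I q k alpha] }.

(* the germ at [p] of [alpha] is in the ideal generated algebraically by
   theta, d theta and omega *)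
Definition generated n (theta : mform M 1) (omega : mform M n) (p : M)
    k (alpha : mform M k) : Prop :=
  forall J : (forall l, mform M l -> Prop), is_ideal p J ->
    J 1%N theta -> J 2%N (extd theta) -> J n omega -> J k alpha.

(* Since theta vanishes nowhere, its kernel is a subbundle of codimension 1. *)
Definition contact_form (N : set M) (D : plane_field M) (theta : mform M 1)
    : Prop :=
  is_form N theta /\
  forall p i, N p -> dom i p ->
    [/\ forall v, D i (chart i p) v <-> theta i (chart i p) v = 0,
        exists v, theta i (chart i p) v != 0
      & forall u, D i (chart i p) u ->
          (forall w, D i (chart i p) w ->
             extd theta i (chart i p) (col_mx u w) = 0) -> u = 0].

Definition contact_structure (N : set M) (D : plane_field M) : Prop :=
  open N /\
  forall p, N p -> exists (W : set M) (theta : mform M 1),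
    [/\ open W, W p, W `<=` N & contact_form W D theta].

Definition isotropic (N : set M) (theta : mform M 1) (E : plane_field M)
    : Prop :=
  forall p i, N p -> dom i p ->
    forall u w, E i (chart i p) u -> E i (chart i p) w ->
      extd theta i (chart i p) (col_mx u w) = 0.

Definition lagrangian_pair (n : nat) (N : set M) (D E1 E2 : plane_field M)
    : Prop :=
  [/\ is_subbundle N n E1, is_subbundle N n E2,
      forall p, N p -> exists (W : set M) (theta : mform M 1),
        [/\ open W, W p & contact_form W D theta] /\
        (isotropic W theta E1 /\ isotropic W theta E2),
      forall p i, N p -> dom i p -> forall v, D i (chart i p) v <->
        exists u w, [/\ E1 i (chart i p) u, E2 i (chart i p) w & v = u + w]
    & forall p i, N p -> dom i p -> forall v,
        E1 i (chart i p) v -> E2 i (chart i p) v -> v = 0].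

(* i_u omega = 0 for all u in E *)
Definition contracts_to_0 (N : set M) n (E : plane_field M) (omega : mform M n)
    : Prop :=
  forall p i, N p -> dom i p -> forall (v : 'M[R]_(n, m)) (a : 'I_n),
    a = 0%N :> nat -> E i (chart i p) (row a v) -> omega i (chart i p) v = 0.

(* the restriction of the [n]-form omega to the rank [n] bundle E is a volume
   form *)
Definition volume_on (N : set M) n (E : plane_field M) (omega : mform M n)
    : Prop :=
  forall p i, N p -> dom i p -> exists v : 'M[R]_(n, m),
    (forall a, E i (chart i p) (row a v)) /\ omega i (chart i p) v != 0.

Definition bidecomposing n (N : set M) (E1 E2 : plane_field M)
    (omega1 omega2 : mform M n) : Prop :=
  [/\ is_form N omega1 /\ is_form N omega2,
      contracts_to_0 N E2 omega1, contracts_to_0 N E1 omega2,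
      volume_on N E1 omega1 & volume_on N E2 omega2].

Definition local_generator n (N : set M) (D : plane_field M) (I : form_sheaf)
    (omega : mform M n) : Prop :=
  is_form N omega /\
  exists theta : mform M 1, contact_form N D theta /\
    forall p, N p -> forall k (alpha : mform M k),
      I p k alpha <-> generated theta omega p alpha.

Definition MA_system (n : nat) (N : set M) (D : plane_field M)
    (I : form_sheaf) : Prop :=
  [/\ contact_structure N D, is_EDS N I
    & forall p, N p -> exists (W : set M) (omega : mform M n),
        [/\ open W, W p, W `<=` N & local_generator W D I omega]].

Definition MA_system_with_pair (n : nat) (N : set M) (D E1 E2 : plane_field M)
    (I : form_sheaf) : Prop :=
  [/\ MA_system n N D I, lagrangian_pair n N D E1 E2
    & forall p, N p -> exists (W : set M) (omega1 omega2 : mform M n),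
        [/\ open W, W p, W `<=` N, bidecomposing W E1 E2 omega1 omega2
          & local_generator W D I (subf omega1 omega2)]].

End OnManifold.

(* [Phi^* I' = I] on [N] *)
Definition pulls_back_to (M M' : manifold R m) (N : set M) (Phi : M -> M')
    (I' : form_sheaf M') (I : form_sheaf M) : Prop :=
  forall p, N p -> forall k (beta : mform M k), I p k beta <->
    exists2 alpha : mform M' k, I' (Phi p) k alpha &
      exists W : set M, [/\ open W, W p & is_pullback W Phi alpha beta].

Definition MA_isomorphism (M M' : manifold R m) (N : set M) (U : set M')
    (Phi : M -> M') (Psi : M' -> M) (D : plane_field M) (I : form_sheaf M)
    (D' : plane_field M') (I' : form_sheaf M') : Prop :=
  [/\ diffeo N U Phi Psi, pushes_to N Phi D D' & pulls_back_to N Phi I' I].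

End Geometry.

Section Standard.
Variables (R : realType) (n : nat).

(* R^(2n+1) with coordinates (x_1, .., x_n, z, p_1, .., p_n), in this order *)
Definition dim2n1 : nat := n + (1 + n).
Notation Rst := (euclid R dim2n1).

Definition ix (a : 'I_n) : 'I_dim2n1 := lshift (1 + n) a.
Definition iz : 'I_dim2n1 := rshift n (lshift n (ord0 : 'I_1)).
Definition ip (a : 'I_n) : 'I_dim2n1 := rshift n (rshift 1 a).

Definition dcoord (c : 'I_dim2n1) : mform Rst 1 := fun _ _ v => v 0 c.
Definition dx (a : 'I_n) := dcoord (ix a).
Definition dz := dcoord iz.
Definition dp (a : 'I_n) := dcoord (ip a).

Definition theta_st : mform Rst 1 := fun i y v =>
  dz i y v - \sum_(a < n) y 0 (ip a) * dx a i y v.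

Definition D_st : plane_field Rst := fun i y v => theta_st i y v = 0.
Definition E1_st : plane_field Rst := fun i y v =>
  D_st i y v /\ forall a, dp a i y v = 0.
Definition E2_st : plane_field Rst := fun i y v =>
  D_st i y v /\ forall a, dx a i y v = 0.

(* F dx_1 /\ .. /\ dx_n - dp_1 /\ .. /\ dp_n *)
Definition hesse_form (F : 'rV[R]_dim2n1 -> R) : mform Rst n := fun i y v =>
  F y * wedges dx i y v - wedges dp i y v.

Variable M : manifold R dim2n1.

Definition flat_pair (D E1 E2 : plane_field M) : Prop :=
  forall p : M, exists (N : set M) (U : set Rst)
      (Phi : M -> Rst) (Psi : Rst -> M),
    [/\ N p, diffeo N U Phi Psi, pushes_to N Phi D D_st,
        pushes_to N Phi E1 E1_st & pushes_to N Phi E2 E2_st].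

Definition hesse_MA_system (D E1 E2 : plane_field M) (I : form_sheaf M)
    : Prop :=
  MA_system_with_pair n setT D E1 E2 I /\ flat_pair D E1 E2.

(* [Phi = (x, z, p)] are Darboux coordinates on [N], with image [U], in which
   [I] is represented by Hess(z) = F *)
Definition represented_by_hess (N : set M) (U : set Rst) (Phi : M -> Rst)
    (Psi : Rst -> M) (D : plane_field M) (I : form_sheaf M)
    (F : 'rV[R]_dim2n1 -> R) : Prop :=
  [/\ diffeo N U Phi Psi, pushes_to N Phi D D_st
    & exists (theta : mform M 1) (omega : mform M n),
        [/\ is_pullback N Phi theta_st theta,
            is_pullback N Phi (hesse_form F) omega
          & forall p, N p -> forall k (alpha : mform M k),
              I p k alpha <-> generated theta omega p alpha]].

End Standard.

(* Main.v *)
From HB Require Import structures.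
From mathcomp Require Import all_boot all_order all_fingroup all_algebra.
From mathcomp Require Import all_classical all_reals all_analysis.
Require Import Defs.
Set Implicit Arguments.
Unset Strict Implicit.
Unset Printing Implicit Defensive.
Import Order.TTheory GRing.Theory Num.Theory.
Import numFieldNormedType.Exports.
Local Open Scope classical_set_scope.
Local Open Scope ring_scope.

(** Take Darboux coordinates straightening the flat Lagrangian pair.  There
    [omega1] kills [E2_st] and [omega2] kills [E1_st], so on the contact
    distribution they restrict to [a dx_1 /\ .. /\ dx_n] and
    [b dp_1 /\ .. /\ dp_n], with [a], [b] nowhere zero because both are volume
    forms.  Two [n]-forms agreeing on the contact distribution differ by a
    multiple of [theta_st], hence [omega1 - omega2] and
    [F dx_1 /\ .. /\ dx_n - dp_1 /\ .. /\ dp_n], with [F = a / b], generate the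
    same ideal together with [theta_st] and [d theta_st].  The given contact
    form is [g theta_st], and [d (g theta_st) = dg /\ theta_st + g d theta_st]
    shows that it may be replaced by [theta_st].  Closedness under [d] of the
    transported ideal is inherited through the naturality of [d]. *)

(** * Smooth functions *)

(** Membership in [generated] means membership in every ideal of germs containing the generators, so
    no form is ever written out as a combination of them. Two systems of generators are compared by
    showing that an ideal containing one contains the other, and to do this across the
    diffeomorphism, ideals of germs are transported in both directions. The obstacle is the encoding
    of forms by local expressions in all charts, which are meaningful only on the chart images and
    related only where compatibility is known. Shrinking the neighborhood into the domain of one
    chart [i0] allows a form to be pushed forward through that chart alone. Pulling back and pushing
    forward are then inverse up to equality near a point, which [ideal_germ] absorbs. Smoothness of
    a form is given for constant vectors only, whereas transported forms are evaluated on vectors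
    that move with the point. Multilinearity bridges this gap, both for smoothness and for the
    Leibniz rule behind the naturality of [d]. *)

(** The differential is characterised by a little-o expansion at the point, which only sees values
    nearby; [diff_unique] then identifies the two differentials. *)
Lemma differentiable_near_eq (R : numFieldType) (V W : normedModType R)
    (f g : V -> W) (x : V) :
  (\near x, f x = g x) -> differentiable f x ->
  differentiable g x /\ ('d g x = 'd f x :> (V -> W)).
Proof.
move=> fg df; have [dfc dfE] := (diff_locallyP _ _).1 df.
suff gE : g \o shift x = cst (g x) + 'd f x +o_ 0 id.
  have gf := diff_unique dfc gE; split=> //.
  by apply/diff_locallyP; rewrite gf.
have fx : f x = g x by exact: (nbhs_singleton fg).
apply/eqaddoP => e e0; move/eqaddoP : dfE => /(_ e e0).
have fg0 : \forall h \near (0 : V), f (h + x) = g (h + x).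
  have /= := near_shift 0 x (fun y => f y = g y).
  by rewrite subr0 => <-.
rewrite -fx; apply: filterS2 fg0 => h fgh.
by rewrite /= !fctE /= fgh.
Qed.

(** [foldr] applies the last direction of the list first, so lists are peeled from the right. *)
Lemma smooth_onP (R : realType) (V W : normedModType R) (O : set V) (f : V -> W) :
  smooth_on O f <-> (forall y, O y -> differentiable f y) /\
                    (forall v, smooth_on O ('D_v f)).
Proof.
split=> [sf|[df sf] s].
  split=> [y Oy|v s y Oy]; first exact: (sf [::]).
  by have := sf (rcons s v) y Oy; rewrite foldr_rcons.
by case/lastP: s => [//|s v y Oy]; rewrite foldr_rcons; exact: sf.
Qed.

(* Finite differentiability classes, so that smoothness is proved by induction
   on the order. *)
Fixpoint Ck (R : realType) (V W : normedModType R) n (O : set V) (f : V -> W)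
    {struct n} : Prop :=
  (forall y, O y -> differentiable f y) /\
  (if n is k.+1 then forall v, Ck k O ('D_v f) else True).

Lemma Ck_diff (R : realType) (V W : normedModType R) n (O : set V) (f : V -> W) y :
  Ck n O f -> O y -> differentiable f y.
Proof. by case: n => [|n] [df _] /df. Qed.

Ltac Ck_differentiable := apply: Ck_diff; eassumption.

Section Ck.
Variables (R : realType) (V : normedModType R).
Implicit Types (O : set V).

Lemma CkS (W : normedModType R) n O (f : V -> W) v :
  Ck n.+1 O f -> Ck n O ('D_v f).
Proof. by case=> _; exact. Qed.

Lemma smooth_Ck (W : normedModType R) O (f : V -> W) :
  smooth_on O f <-> (forall n, Ck n O f).
Proof.
split=> [sf n|Cf s].
  elim: n f sf => [|n IH] f /smooth_onP[df sf]; split=> // v.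
  exact: IH.
elim/last_ind: s f Cf => [|s w IH] f Cf y Oy.
  exact: Ck_diff (Cf 0%N) Oy.
by rewrite foldr_rcons; apply: IH => // n; exact: CkS.
Qed.

Lemma Ck_smooth (W : normedModType R) n O (f : V -> W) : smooth_on O f -> Ck n O f.
Proof. by move/smooth_Ck; exact. Qed.

Lemma CkW (W : normedModType R) n O (f : V -> W) : Ck n.+1 O f -> Ck n O f.
Proof.
by elim: n f => [|n IH] f [df Cf]; split=> // v; exact/IH/Cf.
Qed.

Lemma eq_Ck (W : normedModType R) n O (f g : V -> W) :
  open O -> (forall y, O y -> f y = g y) -> Ck n O f -> Ck n O g.
Proof.
move=> oO fg; have fgn y (Oy : O y) (f' g' : V -> W) :
    (forall y, O y -> f' y = g' y) -> \near y, f' y = g' y.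
  by move=> fg'; apply: filterS (open_nbhs_nbhs (conj oO Oy)).
elim: n f g fg => [|n IH] f g fg [df Cf]; (split; last try by []).
- by move=> y Oy; case: (differentiable_near_eq (fgn y Oy _ _ fg) (df y Oy)).
- by move=> y Oy; case: (differentiable_near_eq (fgn y Oy _ _ fg) (df y Oy)).
- by move=> v; apply: IH (Cf v) => y Oy; exact: near_eq_derive (fgn y Oy _ _ fg).
Qed.

Lemma Ck_cst (W : normedModType R) n O (c : W) : Ck n O (fun=> c).
Proof.
elim: n c => [|n IH] c; (split; [by move=> y _; exact: differentiable_cst|try by []]) => v.
by rewrite (_ : 'D_v _ = fun=> 0)//; apply/funext => y; rewrite derive_cst.
Qed.

Lemma CkD (W : normedModType R) n O (f g : V -> W) : open O ->
  Ck n O f -> Ck n O g -> Ck n O (fun y => f y + g y).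
Proof.
move=> oO; elim: n f g => [|n IH] f g Cf Cg; (split;
  [by move=> y Oy; apply: differentiableD; Ck_differentiable|try by []]) => v.
apply: (@eq_Ck _ _ _ (fun y => 'D_v f y + 'D_v g y)) => //.
  move=> y Oy; rewrite -[RHS]/('D_v (f + g) y) deriveD //;
    by apply: diff_derivable; Ck_differentiable.
by apply: IH; exact: CkS.
Qed.

Lemma Ck_lin (W W' : normedModType R) n O (f : V -> W) (L : {linear W -> W'}) :
  open O -> continuous L -> Ck n O f -> Ck n O (L \o f).
Proof.
move=> oO cL; elim: n f => [|n IH] f Cf; (split;
  [by move=> y Oy; apply: differentiable_comp;
     [Ck_differentiable|exact: linear_differentiable]|try by []]) => v.
apply: (@eq_Ck _ _ _ (L \o 'D_v f)) => //; last exact/IH/CkS.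
move=> y Oy; have df := Ck_diff Cf Oy.
have dL : differentiable L (f y) by exact: linear_differentiable.
rewrite [RHS]deriveE; last exact: differentiable_comp.
by rewrite diff_comp //= diff_lin //= deriveE.
Qed.

Lemma CkM n O (f g : V -> R^o) : open O ->
  Ck n O f -> Ck n O g -> Ck n O (fun y => f y * g y : R^o).
Proof.
move=> oO; elim: n f g => [|n IH] f g Cf Cg; (split;
  [by move=> y Oy; apply: differentiableM; Ck_differentiable|try by []]) => v.
apply: (@eq_Ck _ _ _ (fun y => f y * 'D_v g y + g y * 'D_v f y : R^o)) => //.
  move=> y Oy; rewrite -[RHS]/('D_v (f * g) y) deriveM //;
    by apply: diff_derivable; Ck_differentiable.
by apply: CkD => //; apply: IH; solve [exact: CkW|exact: CkS].
Qed.

(** The derivative of [1/f] is [-(1/f)^2] times that of [f]. It involves [1/f] only to the previous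
    order, so the induction closes. *)
Lemma CkV n O (f : V -> R^o) : open O -> (forall y, O y -> f y != 0) ->
  Ck n O f -> Ck n O (fun y => (f y)^-1 : R^o).
Proof.
move=> oO f0; elim: n f f0 => [|n IH] f f0 Cf; (split;
  [by move=> y Oy; apply: differentiableV; [Ck_differentiable|exact: f0]|try by []]) => v.
apply: (@eq_Ck _ _ _ (fun y => (f y)^-1 * (f y)^-1 * (-1 * 'D_v f y) : R^o)) => //.
  move=> y Oy; rewrite (@deriveV _ _ f y v) ?f0 //; last first.
    by apply: diff_derivable; Ck_differentiable.
  by rewrite mulN1r -exprVn -expr2 mulrN scaleNr.
have Cf' : Ck n O (fun y => (f y)^-1 : R^o) by apply: IH => //; exact: CkW.
apply: CkM => //; first exact: CkM.
by apply: CkM => //; [exact: Ck_cst|exact: CkS].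
Qed.

End Ck.

Section CkMatrix.
Variables (R : realType) (V : normedModType R).
Implicit Types (O : set V).

Lemma Ck_sum (W : normedModType R) n O (I : Type) (r : seq I) (f : I -> V -> W) :
  open O -> (forall i, Ck n O (f i)) -> Ck n O (fun y => \sum_(i <- r) f i y).
Proof.
move=> oO Cf; elim: r => [|i r IH].
  by under eq_fun do rewrite big_nil; exact: Ck_cst.
by under eq_fun do rewrite big_cons; exact: CkD.
Qed.

Lemma Ck_coord n O k l (F : V -> 'M[R]_(k, l)) i j : open O ->
  Ck n O F -> Ck n O (fun y => F y i j : R^o).
Proof.
move=> oO; pose c (N : 'M[R]_(k, l)) : R^o := N i j.
have cl : linear c by move=> a x y; rewrite /c !mxE.
pose cM := GRing.isLinear.Build _ _ _ _ _ cl.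
pose cL : {linear _ -> _} := HB.pack c cM.
by apply: (@Ck_lin _ _ _ _ _ _ _ cL) => // x; exact: coord_continuous.
Qed.

Lemma Ck_mx n O k l (F : V -> 'M[R]_(k, l)) : open O ->
  (forall i j, Ck n O (fun y => F y i j : R^o)) -> Ck n O F.
Proof.
move=> oO CF; rewrite (_ : F = fun y => \sum_i \sum_j F y i j *: delta_mx i j); last first.
  by apply/funext => y; rewrite [LHS]matrix_sum_delta.
apply: Ck_sum => // i; apply: Ck_sum => // j.
have cl : linear (fun a : R^o => a *: delta_mx i j : 'M[R]_(k, l)).
  by move=> a x y; rewrite scalerDl scalerA.
pose cM := GRing.isLinear.Build _ _ _ _ _ cl.
pose cL : {linear _ -> _} := HB.pack (fun a : R^o => a *: delta_mx i j : 'M[R]_(k, l)) cM.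
by apply: (@Ck_lin _ _ _ _ _ _ _ cL) => // x; exact: scalel_continuous.
Qed.

Lemma derive_coord m (W : normedModType R) (f : 'rV[R]_m -> W) x v :
  differentiable f x ->
  'D_v f x = \sum_j v 0 j *: 'D_(delta_mx 0 j) f x.
Proof.
move=> df; rewrite deriveE // [v in LHS]row_sum_delta linear_sum.
by apply: eq_bigr => j _; rewrite linearZ deriveE.
Qed.

Lemma derive_mxE m k (F : V -> 'M[R]_(m, k)) x v i j :
  differentiable F x -> ('D_v F x) i j = 'D_v (fun y => F y i j : R^o) x.
Proof. by move=> dF; rewrite derive_mx ?mxE //; exact: diff_derivable. Qed.

Lemma Ck_comp n m O (O' : set 'rV[R]_m) (f : 'rV[R]_m -> R^o) (g : V -> 'rV[R]_m) :
  open O -> open O' -> (forall y, O y -> O' (g y)) ->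
  Ck n O' f -> Ck n O g -> Ck n O (f \o g).
Proof.
move=> oO oO' gO; elim: n f => [|n IH] f Cf Cg;
  have dfg : forall y, O y -> differentiable (f \o g) y by
    [move=> y Oy; have O'y := gO _ Oy; apply: differentiable_comp; Ck_differentiable];
  split=> // v.
(* Chain rule in coordinates: the derivative of the composite is a sum of products of functions of
   order [n], among them composites covered by the induction hypothesis. *)
apply: (@eq_Ck _ _ _ _ _ (fun y => \sum_j
    ('D_v g y) 0 j * ('D_(delta_mx 0 j) f \o g) y : R^o)) => //.
  move=> y Oy; have O'y := gO _ Oy.
  have df : differentiable f (g y) by Ck_differentiable.
  have dg : differentiable g y by Ck_differentiable.
  have dcomp : 'D_v (f \o g) y = 'd f (g y) ('d g y v).
    by rewrite deriveE; [rewrite diff_comp|exact: dfg].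
  by rewrite dcomp -!deriveE // [RHS]derive_coord.
apply: Ck_sum => // j; apply: CkM => //.
  by apply: Ck_coord => //; exact: CkS.
by apply: IH; [exact: CkS|exact: CkW].
Qed.

End CkMatrix.

Section Smooth.
Variables (R : realType) (V : normedModType R).
Implicit Types (O : set V).

Lemma smooth_diff (W : normedModType R) O (f : V -> W) y :
  smooth_on O f -> O y -> differentiable f y.
Proof. by move=> /(_ [::]); exact. Qed.

Lemma smooth_derive (W : normedModType R) O (f : V -> W) v :
  smooth_on O f -> smooth_on O ('D_v f).
Proof. by case/smooth_onP. Qed.

Lemma eq_smooth (W : normedModType R) O (f g : V -> W) :
  open O -> (forall y, O y -> f y = g y) -> smooth_on O f -> smooth_on O g.
Proof. by move=> oO fg /smooth_Ck sf; apply/smooth_Ck => n; exact: eq_Ck (sf n). Qed.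

Lemma sub_smooth (W : normedModType R) O O' (f : V -> W) :
  O' `<=` O -> smooth_on O f -> smooth_on O' f.
Proof. by move=> sO sf s y /sO; exact: sf. Qed.

Lemma smooth_cst (W : normedModType R) O (c : W) : smooth_on O (fun=> c).
Proof. by apply/smooth_Ck => n; exact: Ck_cst. Qed.

Lemma smoothD (W : normedModType R) O (f g : V -> W) : open O ->
  smooth_on O f -> smooth_on O g -> smooth_on O (fun y => f y + g y).
Proof.
by move=> oO /smooth_Ck sf /smooth_Ck sg; apply/smooth_Ck => n; exact: CkD.
Qed.

Lemma smoothM O (f g : V -> R^o) : open O ->
  smooth_on O f -> smooth_on O g -> smooth_on O (fun y => f y * g y : R^o).
Proof.
by move=> oO /smooth_Ck sf /smooth_Ck sg; apply/smooth_Ck => n; exact: CkM.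
Qed.

Lemma smoothN O (f : V -> R^o) : open O ->
  smooth_on O f -> smooth_on O (fun y => - f y : R^o).
Proof.
move=> oO sf; under eq_fun do rewrite -mulN1r.
by apply: smoothM => //; exact: smooth_cst.
Qed.

Lemma smoothV O (f : V -> R^o) : open O -> (forall y, O y -> f y != 0) ->
  smooth_on O f -> smooth_on O (fun y => (f y)^-1 : R^o).
Proof.
by move=> oO f0 /smooth_Ck sf; apply/smooth_Ck => n; exact: CkV.
Qed.

Lemma smooth_sum (W : normedModType R) O (I : Type) (r : seq I) (f : I -> V -> W) :
  open O -> (forall i, smooth_on O (f i)) -> smooth_on O (fun y => \sum_(i <- r) f i y).
Proof.
by move=> oO sf; apply/smooth_Ck => n; apply: Ck_sum => // i; exact: Ck_smooth.
Qed.

Lemma smooth_mxP O k l (F : V -> 'M[R]_(k, l)) : open O ->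
  smooth_on O F <-> (forall i j, smooth_on O (fun y => F y i j : R^o)).
Proof.
move=> oO; split=> [/smooth_Ck sF i j|sF]; apply/smooth_Ck => n.
  exact: Ck_coord.
by apply: Ck_mx => // i j; exact: Ck_smooth.
Qed.

Lemma smooth_coord O k l (F : V -> 'M[R]_(k, l)) i j : open O ->
  smooth_on O F -> smooth_on O (fun y => F y i j : R^o).
Proof. by move=> oO /(smooth_mxP _ oO). Qed.

Lemma smooth_comp m O (O' : set 'rV[R]_m) (f : 'rV[R]_m -> R^o) (g : V -> 'rV[R]_m) :
  open O -> open O' -> (forall y, O y -> O' (g y)) ->
  smooth_on O' f -> smooth_on O g -> smooth_on O (f \o g).
Proof.
move=> oO oO' gO /smooth_Ck sf /smooth_Ck sg.
by apply/smooth_Ck => n; exact: Ck_comp (sf n) (sg n).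
Qed.

End Smooth.

Section SmoothMatrix.
Variables (R : realType) (V : normedModType R).
Implicit Types (O : set V).

Lemma smooth_mulmx k l q O (F : V -> 'M[R]_(k, l)) (G : V -> 'M[R]_(l, q)) :
  open O -> smooth_on O F -> smooth_on O G -> smooth_on O (fun y => F y *m G y).
Proof.
move=> oO /(smooth_mxP _ oO) sF /(smooth_mxP _ oO) sG.
apply/smooth_mxP => // i j; under eq_fun do rewrite mxE.
by apply: smooth_sum => // a; exact: smoothM.
Qed.

End SmoothMatrix.

Lemma smooth_id (R : realType) m (O : set 'rV[R]_m) : smooth_on O (fun y : 'rV[R]_m => y).
Proof. exact: smooth_on_id. Qed.

Lemma smooth_jacobian (R : realType) k m (O : set 'rV[R]_k) (f : 'rV[R]_k -> 'rV[R]_m) :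
  open O -> smooth_on O f -> smooth_on O (fun y => 'J f y).
Proof.
move=> oO sf; apply/smooth_mxP => // i j.
apply: (@eq_smooth _ _ _ _ (fun y => ('D_(delta_mx 0 i) f y) 0 j : R^o)) => //.
  by move=> y Oy; rewrite mxE deriveE //; exact: smooth_diff Oy.
by apply: smooth_coord => //; exact: smooth_derive.
Qed.

(** * Symmetry of second derivatives *)

Section Schwarz.
Variables (R : realType) (V : normedModType R).

Lemma is_derive_line (W : normedModType R) (f : V -> W) x u (s : R) :
  differentiable f (x + s *: u) ->
  is_derive s 1 (fun s : R => f (x + s *: u)) ('D_u f (x + s *: u)).
Proof.
have E : (fun h : R =>
      h^-1 *: (((fun s : R => f (x + s *: u)) \o shift s) (h *: 1) - f (x + s *: u))) =
    (fun h => h^-1 *: ((f \o shift (x + s *: u)) (h *: u) - f (x + s *: u))).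
  apply/funext => h /=; congr (_ *: (f _ - _)).
  by rewrite [h%:A]mulr1 scalerDl addrCA.
move=> df; have dfu : derivable f (x + s *: u) u by exact: diff_derivable.
by split; rewrite /derivable /derive E.
Qed.

(* The left-hand side is symmetric in [u] and [v]: applying the lemma twice and
   letting [h] tend to 0 gives the symmetry of second derivatives. *)
Lemma second_difference (O : set V) (f : V -> R^o) (x u v : V) (h : R) :
  smooth_on O f -> 0 < h ->
  (forall s t : R, 0 <= s <= h -> 0 <= t <= h -> O (x + s *: u + t *: v)) ->
  exists a b : R, [/\ 0 <= a <= h, 0 <= b <= h &
    f (x + h *: u + h *: v) - f (x + h *: u) - f (x + h *: v) + f x =
    h * (h * 'D_v ('D_u f) (x + a *: u + b *: v))].
Proof.
move=> sf h0 Oh.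
have hh : 0 <= h <= h by rewrite lexx ltW.
have h00 : 0 <= (0 : R) <= h by rewrite lexx ltW.
(* [phi] is the increment of [f] in the direction [h v] along a line of direction [u], so the second
   difference is [phi h - phi 0]. The mean value theorem in [s], then in [t], yields the two factors
   [h]. *)
pose phi (s : R) : R^o := f (x + h *: v + s *: u) - f (x + s *: u).
have dphi (s : R) : 0 <= s <= h ->
  is_derive s 1 phi ('D_u f (x + h *: v + s *: u) - 'D_u f (x + s *: u)).
  move=> sh; apply: is_deriveB; apply: is_derive_line; apply: smooth_diff sf _.
    by rewrite addrAC; exact: Oh.
  by rewrite -[_ + _]addr0 -(scale0r v); exact: Oh.
have [||a ah] := @MVT_segment R phi
    (fun s => 'D_u f (x + h *: v + s *: u) - 'D_u f (x + s *: u)) 0 h (ltW h0).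
- by move=> s; rewrite in_itv /= => /andP[s0 sh]; apply: dphi; rewrite !ltW.
- apply: derivable_within_continuous => s; rewrite in_itv /= => sh.
  by have [] := dphi s sh.
rewrite in_itv /= in ah; rewrite subr0 => phiE.
pose psi (t : R) : R^o := 'D_u f (x + a *: u + t *: v).
have dpsi (t : R) : 0 <= t <= h ->
  is_derive t 1 psi ('D_v ('D_u f) (x + a *: u + t *: v)).
  move=> th; apply: is_derive_line; apply: smooth_diff (smooth_derive _ sf) _.
  exact: Oh.
have [||b bh] := @MVT_segment R psi
    (fun t => 'D_v ('D_u f) (x + a *: u + t *: v)) 0 h (ltW h0).
- by move=> s; rewrite in_itv /= => /andP[s0 sh]; apply: dpsi; rewrite !ltW.
- apply: derivable_within_continuous => s; rewrite in_itv /= => sh.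
  by have [] := dpsi s sh.
rewrite in_itv /= in bh; rewrite subr0 => psiE.
exists a, b; split=> //.
have -> : f (x + h *: u + h *: v) - f (x + h *: u) - f (x + h *: v) + f x = phi h - phi 0.
  rewrite /phi !scale0r !addr0 opprB addrA [x + h *: v + h *: u]addrAC.
  by rewrite [in RHS]addrAC.
rewrite phiE mulrC; congr (_ * _).
by rewrite [RHS]mulrC -psiE /psi scale0r addr0 [x + a *: u + _]addrAC.
Qed.

(** The mean value theorem produces a different intermediate point for each order of
    differentiation. Values that coincide at two distinct points, both arbitrarily close to [x], are
    enough for continuous functions. *)
Lemma eq_at_limit (g1 g2 : V -> R) (x : V) (O : set V) : open O -> O x ->
  {for x, continuous g1} -> {for x, continuous g2} ->
  (forall r : R, 0 < r -> ball x r `<=` O -> exists y y',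
    [/\ ball x r y, ball x r y' & g1 y = g2 y']) ->
  g1 x = g2 x.
Proof.
move=> oO Ox c1 c2 H.
apply/eqP; rewrite -subr_eq0 -normr_le0; apply/ler_addgt0Pl => e e0.
rewrite addr0.
have e2 : 0 < e / 2 by rewrite divr_gt0.
move/cvgrPdist_lt : c1 => /(_ _ e2) c1; move/cvgrPdist_lt : c2 => /(_ _ e2) c2.
have Ox' := open_nbhs_nbhs (conj oO Ox).
have [r /= r0 rB] := (nbhs_ballP x _).1 (filterI Ox' (filterI c1 c2)).
have [|y [y' [/rB[_ [/= H1 _]] /rB[_ [_ /= H2]] E]]] := H r r0; first by move=> y /rB[].
rewrite -E in H2.
have -> : g1 x - g2 x = (g1 x - g1 y) - (g2 x - g1 y) by rewrite opprB addrA subrK.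
apply: le_trans (ler_normB _ _) _; rewrite (splitr e).
by apply: lerD; exact: ltW.
Qed.

Lemma derive_comm (O : set V) (f : V -> R^o) (x u v : V) :
  open O -> smooth_on O f -> O x -> 'D_u ('D_v f) x = 'D_v ('D_u f) x.
Proof.
move=> oO sf Ox; apply: (@eq_at_limit ('D_u ('D_v f)) ('D_v ('D_u f)) _ _ oO Ox).
- apply: (@differentiable_continuous _ _ R^o).
  by apply: smooth_diff Ox; do 2 apply: smooth_derive.
- apply: (@differentiable_continuous _ _ R^o).
  by apply: smooth_diff Ox; do 2 apply: smooth_derive.
move=> r r0 rO.
(* The summand 1 keeps [M] positive when [u = v = 0]. For [s] and [t] in [[0, h]] the displacement
   [s u + t v] has norm at most [h M = r / 2 < r]. *)
pose M := `|u| + `|v| + 1.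
have M0 : 0 < M by rewrite ltr_wpDl // addr_ge0.
pose h := r / 2 / M.
have h0 : 0 < h by rewrite !divr_gt0.
have B (s t : R) : 0 <= s <= h -> 0 <= t <= h -> ball x r (x + s *: u + t *: v).
  move=> /andP[s0 sh] /andP[t0 th].
  rewrite -ball_normE /ball_ /= -[x + _ + _]addrA opprD addNKr normrN.
  apply: (@le_lt_trans _ _ (h * `|u| + h * `|v|)).
    apply: le_trans (ler_normD _ _) _; rewrite !normrZ !ger0_norm //.
    by apply: lerD; exact: ler_wpM2r.
  apply: (@le_lt_trans _ _ (h * M)).
    by rewrite -mulrDr ler_wpM2l ?(ltW h0) // lerDl.
  by rewrite /h divfK ?gt_eqF // ltr_pdivrMr // mulr_natr mulr2n ltrDl.
have B' (s t : R) : 0 <= s <= h -> 0 <= t <= h -> ball x r (x + s *: v + t *: u).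
  by move=> sh th; rewrite addrAC; exact: B.
have [a [b [ah bh E1]]] := second_difference sf h0 (fun s t sh th => rO _ (B s t sh th)).
have [a' [b' [ah' bh' E2]]] :=
  second_difference sf h0 (fun s t sh th => rO _ (B' s t sh th)).
exists (x + a' *: v + b' *: u), (x + a *: u + b *: v).
split; [exact: B'|exact: B|].
have hn0 : h != 0 by rewrite gt_eqF.
move: E2; rewrite [x + h *: v + h *: u]addrAC [_ - f (x + h *: v) - _]addrAC E1.
have K (p q : R) : h * (h * p) = h * (h * q) -> q = p.
  by move=> /(mulfI hn0)/(mulfI hn0).
exact: K.
Qed.

End Schwarz.

(** * Alternating multilinear forms *)

Lemma eq_row' (R : Type) k m (A B : 'M[R]_(k, m)) a :
  row' a B = row' a A <-> (forall i, i != a -> row i B = row i A).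
Proof.
split=> [E i|E].
  rewrite eq_sym => /unlift_some[j -> _].
  have := congr1 (row j) E; move=> /rowP H; apply/rowP => l.
  by have := H l; rewrite !mxE.
apply/matrixP => i j; rewrite !mxE.
have /E/rowP/(_ j) : lift a i != a by rewrite eq_sym neq_lift.
by rewrite !mxE.
Qed.

Lemma row_row' (T : Type) k m (N : 'M[T]_(k.+1, m)) a i :
  row i (row' a N) = row (lift a i) N.
Proof. by apply/rowP => j; rewrite !mxE. Qed.

Section Multilinear.
Variables (R : realType) (m : nat).

(** The linearity half of [alternating_multilinear], with the condition on [row'] restated row by
    row: this suits matrices that are described by their rows. *)
Definition multilinear k (phi : 'M[R]_(k, m) -> R) : Prop :=
  forall (A B C : 'M[R]_(k, m)) (a : 'I_k) (b c : R),
    row a A = b *: row a B + c *: row a C ->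
    (forall i, i != a -> row i B = row i A) ->
    (forall i, i != a -> row i C = row i A) ->
    phi A = b * phi B + c * phi C.

Lemma alt_ml k (phi : 'M[R]_(k, m) -> R) :
  alternating_multilinear phi -> multilinear phi.
Proof.
by move=> [H _] A B C a b c E EB EC; apply: H E _ _; exact/eq_row'.
Qed.

Lemma alternatingP k (phi : 'M[R]_(k, m) -> R) :
  multilinear phi ->
  (forall (A : 'M[R]_(k, m)) (a b : 'I_k), a != b -> row a A = row b A -> phi A = 0) ->
  alternating_multilinear phi.
Proof.
by move=> H H0; split=> // A B C a b c E /eq_row' EB /eq_row' EC; exact: H E EB EC.
Qed.

Definition setrow k (a : 'I_k) (w : 'rV[R]_m) (A : 'M[R]_(k, m)) : 'M[R]_(k, m) :=
  \matrix_i (if i == a then w else row i A).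

Lemma row_setrow k (a i : 'I_k) w (A : 'M[R]_(k, m)) :
  row i (setrow a w A) = if i == a then w else row i A.
Proof. by rewrite rowK. Qed.

Lemma setrow_id k (a : 'I_k) (A : 'M[R]_(k, m)) : setrow a (row a A) A = A.
Proof. by apply/row_matrixP => i; rewrite row_setrow; case: eqP => // ->. Qed.

Lemma ml_setrowD k (phi : 'M[R]_(k, m) -> R) a b c u w A : multilinear phi ->
  phi (setrow a (b *: u + c *: w) A) = b * phi (setrow a u A) + c * phi (setrow a w A).
Proof.
move=> H; apply: (H _ _ _ a); first by rewrite !row_setrow eqxx.
  by move=> i ia; rewrite !row_setrow (negbTE ia).
by move=> i ia; rewrite !row_setrow (negbTE ia).
Qed.

Lemma ml_setrow_sum k (phi : 'M[R]_(k, m) -> R) a I (r : seq I) (c : I -> R)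
    (u : I -> 'rV[R]_m) A : multilinear phi ->
  phi (setrow a (\sum_(j <- r) c j *: u j) A) = \sum_(j <- r) c j * phi (setrow a (u j) A).
Proof.
move=> H; elim: r => [|j r IH].
  have := ml_setrowD a 0 0 0 0 A H.
  by rewrite !big_nil !scale0r addr0 !mul0r addr0.
have := ml_setrowD a (c j) 1 (u j) (\sum_(j <- r) c j *: u j) A H.
by rewrite !big_cons !scale1r mul1r IH.
Qed.

Lemma ml_comb k (phi psi : 'M[R]_(k, m) -> R) b c : multilinear phi -> multilinear psi ->
  multilinear (fun A => b * phi A + c * psi A).
Proof.
move=> H K A B C a s t E EB EC; rewrite (H _ _ _ _ _ _ E EB EC) (K _ _ _ _ _ _ E EB EC).
by rewrite !mulrDr addrACA !(mulrCA b) !(mulrCA c).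
Qed.

Lemma ml_sum k I (r : seq I) (phi : I -> 'M[R]_(k, m) -> R) :
  (forall i, multilinear (phi i)) -> multilinear (fun A => \sum_(i <- r) phi i A).
Proof.
move=> H A B C a s t E EB EC; rewrite !mulr_sumr -big_split /=.
by apply: eq_bigr => i _; exact: H E EB EC.
Qed.

Lemma row_col_mx0 k (w : 'rV[R]_m) (A : 'M[R]_(k, m)) :
  row (ord0 : 'I_k.+1) (col_mx w A : 'M[R]_(1 + k, m)) = w.
Proof.
have -> : (ord0 : 'I_k.+1) = lshift k (ord0 : 'I_1) by exact: val_inj.
by rewrite (@rowKu _ 1 k) row_id.
Qed.

Lemma row_col_mxS k (w : 'rV[R]_m) (A : 'M[R]_(k, m)) i :
  row (lift ord0 i : 'I_k.+1) (col_mx w A : 'M[R]_(1 + k, m)) = row i A.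
Proof.
have -> : (lift ord0 i : 'I_k.+1) = rshift 1 i by exact: val_inj.
by rewrite (@rowKd _ 1 k).
Qed.

Lemma setrow0 k (w : 'rV[R]_m) (A : 'M[R]_(1 + k, m)) :
  setrow (ord0 : 'I_k.+1) w A = col_mx w (dsubmx A).
Proof.
apply/row_matrixP => i; rewrite row_setrow; case: (unliftP ord0 i) => [j|] -> /=.
  rewrite row_col_mxS; apply/rowP => l; rewrite !mxE; congr (A _ _); exact: val_inj.
by rewrite row_col_mx0.
Qed.

Lemma ml_col_mx k (phi : 'M[R]_(1 + k, m) -> R) (w : 'rV[R]_m) :
  @multilinear k.+1 phi -> multilinear (fun A : 'M[R]_(k, m) => phi (col_mx w A)).
Proof.
move=> H A B C a b c E EB EC; apply: (H _ _ _ (lift ord0 a : 'I_k.+1)).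
- by rewrite !row_col_mxS.
- move=> i; case: (unliftP ord0 i) => [j|] -> /=; last by rewrite !row_col_mx0.
  by rewrite (inj_eq lift_inj) !row_col_mxS; exact: EB.
- move=> i; case: (unliftP ord0 i) => [j|] -> /=; last by rewrite !row_col_mx0.
  by rewrite (inj_eq lift_inj) !row_col_mxS; exact: EC.
Qed.

Lemma ml_expand0 k (phi : 'M[R]_(1 + k, m) -> R) (A : 'M[R]_(1 + k, m)) :
  @multilinear k.+1 phi ->
  phi A = \sum_j A ord0 j * phi (col_mx (delta_mx 0 j) (dsubmx A)).
Proof.
move=> H; rewrite -[A in LHS](@setrow_id k.+1 ord0) [row _ _]row_sum_delta.
by rewrite (ml_setrow_sum _ _ _ _ _ H); apply: eq_bigr => j _; rewrite setrow0 mxE.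
Qed.

(** The first row of [C *m B] is a combination of rows of [B]. Expanding along it and freezing the
    chosen row leaves a multilinear map in one row less. *)
Lemma ml_mulmx_eq0 k l (phi : 'M[R]_(k, m) -> R) (B : 'M[R]_(l, m)) (C : 'M[R]_(k, l)) :
  multilinear phi -> (forall f : 'I_k -> 'I_l, phi (rowsub f B) = 0) ->
  phi (C *m B) = 0.
Proof.
elim: k phi C => [|k IH] phi C H H0.
  have <- := H0 (fun i : 'I_0 => False_rect _ (notF (ltn_ord i))).
  by congr (phi _); apply/matrixP => -[].
rewrite -[C *m B](setrow_id ord0) row_mul.
have -> : row ord0 C *m B = \sum_j C ord0 j *: row j B.
  by rewrite mulmx_sum_row; apply: eq_bigr => j _; rewrite mxE.
rewrite (ml_setrow_sum _ _ _ _ _ H) big1 // => j _.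
rewrite (@setrow0 k) -(@mul_dsub_mx _ 1 k) .
rewrite (IH (fun A => phi (col_mx (row j B) A))) ?mulr0 //; first exact: ml_col_mx.
(* The selection [f] of the last [k] rows is completed by [j] for the first one. *)
move=> f; rewrite -[RHS](H0 (fun i : 'I_k.+1 => if unlift ord0 i is Some i' then f i' else j)).
congr (phi _); apply/row_matrixP => i; rewrite row_rowsub.
case: (unliftP ord0 i) => [i'|] ->; rewrite ?liftK ?unlift_none.
  by rewrite row_col_mxS row_rowsub.
by rewrite row_col_mx0.
Qed.

(** The comparison principle for everything below: with [B] the identity it characterises the
    determinant, with [B] a frame it reduces identities between forms to the vectors of the
    frame. *)
Lemma eq_ml_mulmx k l (phi psi : 'M[R]_(k, m) -> R) (B : 'M[R]_(l, m)) (C : 'M[R]_(k, l)) :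
  multilinear phi -> multilinear psi ->
  (forall f : 'I_k -> 'I_l, phi (rowsub f B) = psi (rowsub f B)) ->
  phi (C *m B) = psi (C *m B).
Proof.
move=> H K E; apply/eqP; rewrite -subr_eq0; apply/eqP.
have := @ml_mulmx_eq0 k l _ B C (ml_comb 1 (-1) H K); rewrite mul1r mulN1r; apply=> f.
by rewrite E mul1r mulN1r subrr.
Qed.

End Multilinear.

Section Alternating.
Variables (R : realType) (m k : nat) (phi : 'M[R]_(k, m) -> R).
Hypothesis phi_alt : alternating_multilinear phi.

Let phi_ml := alt_ml phi_alt.

Lemma alt_tperm (a b : 'I_k) (A : 'M[R]_(k, m)) : a != b ->
  phi (row_perm (tperm a b) A) = - phi A.
Proof.
move=> ab; have ba : b != a by rewrite eq_sym.
(* Polarisation: [phi] vanishes when both rows [a] and [b] are the sum of the two original rows.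
   Expanding it leaves only the two mixed terms. *)
pose N u w := setrow a u (setrow b w A).
have NE u w i : row i (N u w) = if i == a then u else if i == b then w else row i A.
  by rewrite !row_setrow.
have NC u w : N u w = setrow b w (setrow a u A).
  apply/row_matrixP => i; rewrite NE !row_setrow.
  by have [->|//] := eqVneq i a; rewrite (negbTE ab).
have N0 u : phi (N u u) = 0.
  by apply: (phi_alt.2 _ a b) => //; rewrite !NE eqxx (negbTE ba) eqxx.
have := N0 (1 *: row a A + 1 *: row b A).
rewrite {1}/N ml_setrowD //.
rewrite -![setrow a _ _]/(N _ _) !NC !ml_setrowD // -!NC !N0 !mul1r add0r addr0.
have -> : N (row a A) (row b A) = A by rewrite /N !setrow_id.
have -> : N (row b A) (row a A) = row_perm (tperm a b) A.
  apply/row_matrixP => i; rewrite NE.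
  have -> : row i (row_perm (tperm a b) A) = row (tperm a b i) A by apply/rowP => j; rewrite !mxE.
  by case: tpermP => [->|->|/eqP/negbTE-> /eqP/negbTE->]; rewrite ?eqxx ?(negbTE ba).
by move=> /eqP; rewrite addrC addr_eq0 => /eqP.
Qed.

Lemma alt_perm (s : 'S_k) (A : 'M[R]_(k, m)) :
  phi (row_perm s A) = (-1) ^+ s * phi A.
Proof.
have [ts -> dts] := prod_tpermP s.
elim: ts dts A => [_|t ts IH /= /andP[dt dts]] A.
  by rewrite big_nil odd_perm1 row_perm1 mul1r.
rewrite big_cons row_permM /= alt_tperm // IH // odd_mul_tperm dt signr_addb mulN1r mulNr.
by [].
Qed.

End Alternating.

(** As functions of [A], both sides are multilinear in the rows. It suffices to take for [A] a
    selection of rows of the identity, which is either a permutation matrix or has two equal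
    rows. *)
Lemma alt_mulmx (R : realType) k m (phi : 'M[R]_(k, m) -> R) (A : 'M[R]_k)
    (X : 'M[R]_(k, m)) :
  alternating_multilinear phi -> phi (A *m X) = \det A * phi X.
Proof.
move=> H; rewrite -[A in RHS]mulmx1 -[A in LHS]mulmx1.
apply: (@eq_ml_mulmx _ _ _ _ (fun A => phi (A *m X)) (fun A => \det A * phi X)).
- move=> A1 A2 A3 a b c E E2 E3; apply: (@alt_ml _ _ _ _ H _ _ _ a).
  + by rewrite !row_mul E mulmxDl !scalemxAl.
  + by move=> i ia; rewrite !row_mul E2.
  + by move=> i ia; rewrite !row_mul E3.
- move=> A1 A2 A3 a b c E E2 E3; rewrite !mulrA -mulrDl; congr (_ * _).
  by apply: (@determinant_multilinear _ _ _ _ _ a _ _ E); exact/eq_row'.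
move=> f; have [/injectiveP inj|] := boolP (injectiveb f).
  have -> : rowsub f 1%:M = row_perm (perm inj) 1%:M :> 'M[R]_k.
    by apply/matrixP => i j; rewrite !mxE permE.
  by rewrite -[row_perm _ 1%:M]/(perm_mx _) -row_permE alt_perm // det_perm.
move=> /injectivePn[i [j ij fij]].
rewrite (H.2 _ i j) ?(determinant_alternate ij) ?mul0r //.
  by move=> l; rewrite !mxE fij.
by apply/rowP => l; rewrite !mxE; apply: eq_bigr => ? _; rewrite !mxE fij.
Qed.

Lemma alt_det (R : realType) n m (g : 'I_n -> 'I_m) :
  alternating_multilinear (fun v : 'M[R]_(n, m) => \det (colsub g v)).
Proof.
apply: alternatingP => [A B C a b c E EB EC|A a b ab E].
  apply: (@determinant_multilinear _ _ _ _ _ a).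
  - by apply/rowP => j; move/rowP/(_ (g j)): E; rewrite !mxE.
  - apply/eq_row' => i ia; move/rowP: (EB _ ia) => H.
    by apply/rowP => j; have := H (g j); rewrite !mxE.
  - apply/eq_row' => i ia; move/rowP: (EC _ ia) => H.
    by apply/rowP => j; have := H (g j); rewrite !mxE.
by apply: (determinant_alternate ab) => j; move/rowP/(_ (g j)): E; rewrite !mxE.
Qed.

(** A permutation sending [i] to [j] is determined by what it does to the remaining points. The
    inverse [ulsf] erases [i] and its image; the lemma serves to reindex sums over permutations with
    one value prescribed. *)
Lemma lift_perm_bij k (i j : 'I_k.+1) :
  {on [pred s : 'S_k.+1 | s i == j], bijective (lift_perm i j)}.
Proof.
pose ulsf (i : 'I_k.+1) (s : 'S_k.+1) l := odflt l (unlift (s i) (s (lift i l))).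
have ulsfK i' (s : 'S_k.+1) l : lift (s i') (ulsf i' s l) = s (lift i' l).
  rewrite /ulsf; have:= neq_lift i' l.
  by rewrite -(can_eq (permK s)) => /unlift_some[] ? ? ->.
have inj_ulsf : injective (ulsf i _).
  move=> s; apply: can_inj (ulsf (s i) s^-1%g) _ => l.
  by rewrite {1}/ulsf ulsfK !permK liftK.
exists (fun s => perm (inj_ulsf s)) => [s _ | s].
  by apply/permP=> l; rewrite permE /ulsf lift_perm_lift lift_perm_id liftK.
rewrite inE => /eqP si; apply/permP => l.
case: (unliftP i l) => [l'|] ->; rewrite ?lift_perm_id //.
by rewrite lift_perm_lift -si permE ulsfK.
Qed.

(* Permutations of [1 + k] points are sorted by the image [a] of the first one. *)
Lemma wedge1E (R : realType) m (M : manifold R m) k (alpha : mform M 1) (gamma : mform M k)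
    i y (v : 'M[R]_(1 + k, m)) :
  alternating_multilinear (gamma i y) ->
  wedge alpha gamma i y v =
  \sum_(a < k.+1) (-1) ^+ a * (alpha i y (row a v) * gamma i y (row' a v)).
Proof.
move=> gamma_alt; rewrite /wedge mul1n.
rewrite (partition_big (fun s : 'S_(1 + k) => s (ord0 : 'I_k.+1)) predT) //=.
rewrite mulr_sumr; apply: eq_bigr => a _.
have -> : \sum_(s : 'S_(1 + k) | s (ord0 : 'I_k.+1) == a)
     (-1) ^+ s * (alpha i y (usubmx (row_perm s v)) * gamma i y (dsubmx (row_perm s v))) =
  \sum_(t : 'S_k) (-1) ^+ a * (alpha i y (row a v) * gamma i y (row' a v)).
  rewrite (reindex (lift_perm (ord0 : 'I_k.+1) a)) /=; last exact: lift_perm_bij.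
  apply: eq_big => [t|t _]; first by rewrite lift_perm_id eqxx.
  have -> : usubmx (row_perm (lift_perm (ord0 : 'I_k.+1) a t) v : 'M[R]_(1 + k, m)) = row a v.
    apply/rowP => j; rewrite !mxE.
    have -> : lshift k (ord0 : 'I_1) = (ord0 : 'I_k.+1) by exact: val_inj.
    by rewrite lift_perm_id.
  have -> : dsubmx (row_perm (lift_perm (ord0 : 'I_k.+1) a t) v : 'M[R]_(1 + k, m)) =
      row_perm t (row' a v).
    apply/matrixP => b j; rewrite !mxE.
    have -> : rshift 1 b = (lift ord0 b : 'I_k.+1) by exact: val_inj.
    by rewrite lift_perm_lift.
  rewrite alt_perm // odd_lift_perm /= signr_addb signr_odd.
  by rewrite -mulrA; congr (_ * _); rewrite [X in _ * X]mulrCA [LHS]mulrA -signr_addb addbb mul1r.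
(* All [k!] permutations with first image [a] contribute the same term, which cancels the
   normalising factor of [wedge]. *)
rewrite sumr_const card_Sn -[X in _ * X]mulr_natl mulKf //.
Qed.

(** Bringing row [a] to the front is a cycle through the rows above it, of sign [(-1)^a]. *)
Lemma alt_row_first (R : realType) m k (phi : 'M[R]_(k.+1, m) -> R) (V : 'M[R]_(k.+1, m)) a :
  alternating_multilinear phi ->
  phi (col_mx (row a V) (row' a V) : 'M[R]_(1 + k, m)) = (-1) ^+ a * phi V.
Proof.
move=> phi_alt.
have -> : (col_mx (row a V) (row' a V) : 'M[R]_(1 + k, m)) = row_perm (lift_perm ord0 a 1) V.
  apply/row_matrixP => i.
  have -> : row i (row_perm (lift_perm ord0 a 1) V) = row (lift_perm ord0 a 1 i) V.
    by apply/rowP => j; rewrite !mxE.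
  case: (unliftP (ord0 : 'I_k.+1) i) => [j|] ->.
    by rewrite row_col_mxS lift_perm_lift perm1 row_row'.
  by rewrite row_col_mx0 lift_perm_id.
by rewrite alt_perm // odd_lift_perm odd_perm1 addbF signr_odd.
Qed.

Lemma alt_col_mx (R : realType) m k (phi : 'M[R]_(k.+1, m) -> R) (w : 'rV[R]_m) :
  alternating_multilinear phi ->
  alternating_multilinear (fun A : 'M[R]_(k, m) => phi (col_mx w A : 'M[R]_(1 + k, m))).
Proof.
move=> H; apply: alternatingP; first exact/ml_col_mx/alt_ml.
move=> A a b ab E; apply: (H.2 _ (lift ord0 a) (lift ord0 b)).
  by rewrite (inj_eq lift_inj).
by rewrite !row_col_mxS.
Qed.

Lemma ml_wedge1 (R : realType) m k (theta : 'rV[R]_m -> R) (gamma : 'M[R]_(k, m) -> R) :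
  (forall (b c : R) u w, theta (b *: u + c *: w) = b * theta u + c * theta w) ->
  multilinear gamma ->
  multilinear (fun v : 'M[R]_(k.+1, m) =>
    \sum_(a < k.+1) (-1) ^+ a * (theta (row a v) * gamma (row' a v))).
Proof.
move=> tl gl; apply: ml_sum => a A B C a' b c E EB EC.
(* In the summand [a], the row that varies is either the argument of [theta] or one of the rows of
   [row' a]. *)
have [aa'|] := eqVneq a' a.
  rewrite aa' in E EB EC => {a' aa'}.
  have -> : row' a A = row' a B by apply/esym/eq_row'.
  have -> : row' a C = row' a B by apply/eq_row' => i ia; rewrite EC // EB.
  by rewrite E tl mulrDl mulrDr -!mulrA !(mulrCA _ ((-1) ^+ a)).
rewrite eq_sym => aa'; have /unlift_some[a1 a1E _] := aa'.
rewrite (EB _ aa') (EC _ aa').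
have -> : gamma (row' a A) = b * gamma (row' a B) + c * gamma (row' a C).
  apply: (gl _ _ _ a1).
  - by rewrite !row_row' -a1E.
  - by move=> i ia; rewrite !row_row' EB // a1E (inj_eq lift_inj).
  - by move=> i ia; rewrite !row_row' EC // a1E (inj_eq lift_inj).
by rewrite !mulrDr !(mulrCA b) !(mulrCA c).
Qed.

Lemma det_row0 (R : comNzRingType) n (A : 'M[R]_n) a : (forall j, A a j = 0) -> \det A = 0.
Proof.
by move=> A0; rewrite (expand_det_row _ a) big1 // => j _; rewrite A0 mul0r.
Qed.

(** * Pullback and exterior derivative *)

Lemma derive_comp (R : realType) (U V W : normedModType R) (g : U -> V) (f : V -> W) x u :
  differentiable g x -> differentiable f (g x) ->
  'D_u (f \o g) x = 'D_('D_u g x) f (g x).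
Proof.
move=> dg df; rewrite deriveE; last exact: differentiable_comp.
by rewrite diff_comp //= !deriveE.
Qed.

Lemma big_lift (R : nmodType) k (a : 'I_k.+1) (F : 'I_k.+1 -> R) :
  \sum_(c < k.+1 | c != a) F c = \sum_(b < k) F (lift a b).
Proof.
rewrite (reindex_omap (lift a) (unlift a)) /=; last first.
  by move=> i; case: (unliftP a i) => [j|] ->; rewrite ?liftK ?eqxx.
by apply: eq_bigl => b; rewrite liftK eqxx andbT eq_sym neq_lift.
Qed.

(** * Forms evaluated on moving points and moving vectors *)

Section Families.
Variables (R : realType) (m : nat).

(** Expanding along the first row replaces that vector by constant ones with smooth coefficients. By
    induction only constant vectors remain, for which smoothness is assumed. *)
Lemma smooth_family (V : normedModType R) k (O : set V) (O' : set 'rV[R]_m)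
    (alpha : 'rV[R]_m -> 'M[R]_(k, m) -> R) (phi : V -> 'rV[R]_m) (X : V -> 'M[R]_(k, m)) :
  open O -> open O' -> (forall y, O y -> O' (phi y)) ->
  (forall y, O' y -> multilinear (alpha y)) ->
  (forall v, smooth_on O' (fun y => alpha y v : R^o)) ->
  smooth_on O phi -> smooth_on O X ->
  smooth_on O (fun y => alpha (phi y) (X y) : R^o).
Proof.
move=> oO oO' pO; elim: k alpha X => [|k IH] alpha X ml sa sphi sX.
  rewrite (_ : (fun _ => _) = (fun y => alpha y 0 : R^o) \o phi); last first.
    by apply/funext => y /=; congr (alpha _ _); apply/matrixP => -[].
  exact: (@smooth_comp _ _ _ _ O').
apply: (@eq_smooth R V R^o O (fun y => \sum_j X y ord0 j *
    alpha (phi y) (col_mx (delta_mx 0 j : 'rV[R]_m)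
      (dsubmx (X y : 'M[R]_(1 + k, m)))) : R^o)) => //.
  by move=> y Oy; rewrite [RHS](@ml_expand0 _ _ k) //; exact/ml/pO.
apply: smooth_sum => // j; apply: smoothM => //; first exact: smooth_coord.
apply: (IH (fun y A => alpha y (col_mx (delta_mx 0 j : 'rV[R]_m) A))
  (fun y => dsubmx (X y : 'M[R]_(1 + k, m)))) => //.
  by move=> y O'y; apply: ml_col_mx; exact: ml.
apply/smooth_mxP => // a b; under eq_fun do rewrite mxE.
exact: smooth_coord.
Qed.

(** Leibniz rule: the expression is differentiated in its base point with the vectors frozen, then
    in one vector at a time. The induction expands the first row as in [smooth_family]. *)
Lemma derive_family (V : normedModType R) k (O : set V) (O' : set 'rV[R]_m)
    (alpha : 'rV[R]_m -> 'M[R]_(k, m) -> R) (phi : V -> 'rV[R]_m) (X : V -> 'M[R]_(k, m)) y u :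
  open O -> open O' -> (forall y, O y -> O' (phi y)) ->
  (forall y, O' y -> multilinear (alpha y)) ->
  (forall v, smooth_on O' (fun y => alpha y v : R^o)) ->
  smooth_on O phi -> smooth_on O X -> O y ->
  'D_u (fun y => alpha (phi y) (X y) : R^o) y =
  'D_('D_u phi y) (fun z => alpha z (X y) : R^o) (phi y) +
  \sum_b alpha (phi y) (setrow b (row b ('D_u X y)) (X y)).
Proof.
move=> oO oO' pO; elim: k alpha X => [|k IH] alpha X ml sa sphi sX Oy.
  rewrite big_ord0 addr0.
  rewrite (_ : (fun _ => _) = (fun z => alpha z (X y) : R^o) \o phi); last first.
    by apply/funext => z /=; congr (alpha _ _); apply/matrixP => -[].
  by apply: derive_comp; [exact: smooth_diff Oy|apply: smooth_diff (sa _) _; exact: pO].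
pose X' z := dsubmx (X z : 'M[R]_(1 + k, m)).
have sX' : smooth_on O X'.
  by apply/smooth_mxP => // a b; under eq_fun do rewrite mxE; exact: smooth_coord.
pose beta j z A := alpha z (col_mx (delta_mx 0 j : 'rV[R]_m) A : 'M[R]_(1 + k, m)).
have mlb j z : O' z -> multilinear (beta j z) by move=> O'z; apply: ml_col_mx; exact: ml.
have sbX j : smooth_on O (fun z => beta j (phi z) (X' z) : R^o).
  by apply: (@smooth_family _ _ O O') => // z; [exact: mlb|exact: sa].
have -> : 'D_u (fun z => alpha (phi z) (X z) : R^o) y =
    'D_u (\sum_(j < m) ((fun z => X z ord0 j : R^o) * (fun z => beta j (phi z) (X' z) : R^o))) y.
  apply: near_eq_derive; apply: filterS (open_nbhs_nbhs (conj oO Oy)) => z Oz.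
  by rewrite fct_sumE [LHS](@ml_expand0 _ _ k) //; exact/ml/pO.
have dX j : derivable (fun z => X z ord0 j : R^o) y u.
  by apply: diff_derivable; apply: smooth_diff Oy; exact: smooth_coord.
have db j : derivable (fun z => beta j (phi z) (X' z) : R^o) y u.
  by apply: diff_derivable; exact: smooth_diff Oy.
rewrite derive_sum; last by move=> j; exact: derivableM.
have E j : 'D_u (fun z => beta j (phi z) (X' z) : R^o) y =
    'D_('D_u phi y) (fun z => beta j z (X' y) : R^o) (phi y) +
    \sum_b beta j (phi y) (setrow b (row b ('D_u X' y)) (X' y)).
  by apply: IH => // [z|v]; [exact: mlb|exact: sa].
under eq_bigr do rewrite deriveM // E.
have -> : 'D_('D_u phi y) (fun z => alpha z (X y) : R^o) (phi y) =
    \sum_j X y ord0 j *: 'D_('D_u phi y) (fun z => beta j z (X' y) : R^o) (phi y).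
  have dbj j : derivable (fun z => beta j z (X' y) : R^o) (phi y) ('D_u phi y).
    by apply: diff_derivable; apply: smooth_diff (pO _ Oy); exact: sa.
  under [RHS]eq_bigr do rewrite -deriveZ //.
  rewrite -derive_sum; last by move=> j; exact: derivableZ.
  apply: near_eq_derive; apply: filterS (open_nbhs_nbhs (conj oO' (pO _ Oy))) => z Oz.
  by rewrite fct_sumE [LHS](@ml_expand0 _ _ k) //; exact: ml.
have dXE b j : ('D_u X' y) b j = ('D_u X y) (lift ord0 b) j.
  have dX' : differentiable X' y by exact: smooth_diff Oy.
  have dX0 : differentiable X y by exact: smooth_diff Oy.
  have F : (fun z => X' z b j : R^o) = (fun z => X z (lift ord0 b) j : R^o).
    by apply/funext => z; rewrite mxE; congr (X z _ _); exact: val_inj.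
  by rewrite (derive_mxE _ _ _ dX') F -(derive_mxE _ _ _ dX0).
rewrite big_split /=; under eq_bigr do rewrite scalerDr.
rewrite big_split /= -addrA; congr (_ + _).
(* The term of row 0 collects the derivatives of the coefficients [X y ord0 j]; the other rows come
   from the induction hypothesis. *)
rewrite big_ord_recl addrC; congr (_ + _).
  rewrite [row ord0 _]row_sum_delta ml_setrow_sum; last exact/ml/pO.
  apply: eq_bigr => j _; rewrite (@setrow0 _ _ k) mxE (@derive_mxE _ _ k.+1).
    by rewrite mulrC.
  exact: smooth_diff Oy.
under eq_bigr do rewrite scaler_sumr.
rewrite exchange_big /=; apply: eq_bigr => b _.
rewrite [RHS](@ml_expand0 _ _ k); last exact/ml/pO.
apply: eq_bigr => j _; rewrite mxE /=; congr (_ * _); first by rewrite mxE.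
rewrite /beta; congr (alpha (phi y) (@col_mx _ 1 k m _ _)).
apply/row_matrixP => c; apply/rowP => l; rewrite !mxE.
have -> : (rshift 1 c == lift ord0 b :> 'I_k.+1) = (c == b).
  have -> : rshift 1 c = lift ord0 c :> 'I_k.+1 by exact: val_inj.
  exact: (inj_eq lift_inj).
by case: eqP => _; rewrite !mxE // dXE.
Qed.

Lemma derive_family_eq (V : normedModType R) k (O : set V) (O' : set 'rV[R]_m)
    (alpha : 'rV[R]_m -> 'M[R]_(k, m) -> R) (phi : V -> 'rV[R]_m) (X : V -> 'M[R]_(k, m)) y u
    (w : 'rV[R]_m) (A : 'M[R]_(k, m)) (h : 'I_k -> 'rV[R]_m) :
  open O -> open O' -> (forall y, O y -> O' (phi y)) ->
  (forall y, O' y -> multilinear (alpha y)) ->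
  (forall v, smooth_on O' (fun y => alpha y v : R^o)) ->
  smooth_on O phi -> smooth_on O X -> O y ->
  'D_u phi y = w -> X y = A -> (forall b, row b ('D_u X y) = h b) ->
  'D_u (fun y => alpha (phi y) (X y) : R^o) y =
  'D_w (fun z => alpha z A : R^o) (phi y) + \sum_b alpha (phi y) (setrow b (h b) A).
Proof.
move=> oO oO' pO ml sa sphi sX Oy <- <- hE.
rewrite (derive_family _ oO oO' pO) //.
by under eq_bigr do rewrite hE.
Qed.

End Families.

(** * Naturality of the exterior derivative *)

Section Naturality.
Variables (R : realType) (m : nat).

(** The formula of [extd] for a single local expression, so that naturality can be stated for a map
    between open sets of coordinate spaces. *)
Definition local_extd k (alpha : 'rV[R]_m -> 'M[R]_(k, m) -> R) :
    'rV[R]_m -> 'M[R]_(k.+1, m) -> R :=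
  fun y v => \sum_(a < k.+1) (-1) ^+ a *
    'D_(row a v) (fun y' => alpha y' (row' a v) : R^o) y.

Lemma row'_setrow k (N : 'M[R]_(k.+1, m)) a b u w :
  row' a (setrow a u (setrow (lift a b) w N)) = setrow b w (row' a N).
Proof.
apply/row_matrixP => i; rewrite row_row' !row_setrow eq_sym (negbTE (neq_lift _ _)).
by rewrite (inj_eq lift_inj) row_row'.
Qed.

(** When rows [a] and [c] agree, deleting one or the other leaves the same rows in a different
    order. The permutation [t] relating them satisfies [lift_perm c a t = tperm a c], which
    determines its sign. *)
Lemma alt_row'_swap k (phi : 'M[R]_(k, m) -> R) (N : 'M[R]_(k.+1, m)) (a c : 'I_k.+1) :
  alternating_multilinear phi -> a != c -> row a N = row c N ->
  (-1) ^+ a * phi (row' a N) + (-1) ^+ c * phi (row' c N) = 0.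
Proof.
move=> phi_alt ac E.
have [inv _ /(_ (tperm a c))] := lift_perm_bij c a.
rewrite inE tpermR => /(_ (eqxx _)); set t := inv _ => tE.
have -> : row' c N = row_perm t (row' a N).
  apply/row_matrixP => i; apply/rowP => j; rewrite !mxE -(lift_perm_lift c) tE.
  case: tpermP => [->|->|//]; last by move/rowP/(_ j): E; rewrite !mxE.
  by move/rowP/(_ j): E; rewrite !mxE => ->.
rewrite alt_perm // mulrA.
have /eqP := odd_lift_perm c a t; rewrite tE odd_tperm ac eq_sym addbC.
move=> /eqP to.
have -> : (-1) ^+ c * (-1) ^+ t = - (-1) ^+ a :> R.
  rewrite -(signr_odd R c) -(signr_odd R a); move: to.
  case: (odd a); case: (odd c); case: (odd_perm t) => //= _;
    by rewrite ?(expr0, expr1, mulrNN, mulr1, mul1r, opprK).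
by rewrite mulNr subrr.
Qed.

Lemma sum_swap0 k (T : 'I_k -> 'I_k -> R) :
  (forall a c, a != c -> T a c + T c a = 0) ->
  \sum_a \sum_(c | c != a) T a c = 0.
Proof.
move=> H; set S := LHS.
have SE : S = \sum_a \sum_(c | c != a) T c a.
  rewrite /S (exchange_big_dep predT) //=; apply: eq_bigr => a _.
  by apply: eq_bigl => c; rewrite eq_sym.
have : S + S = 0.
  rewrite [X in X + _]SE /S -big_split big1 //= => a _.
  by rewrite -big_split big1 //= => c ca; exact: H.
by move/eqP; rewrite -mulr2n mulrn_eq0 => /eqP.
Qed.

Lemma row_derive_mulJ k (O : set 'rV[R]_m) (phi : 'rV[R]_m -> 'rV[R]_m) (A : 'M[R]_(k, m)) y u b :
  open O -> smooth_on O phi -> O y ->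
  row b ('D_u (fun y => A *m 'J phi y) y) = 'D_u ('D_(row b A) phi) y.
Proof.
move=> oO sphi Oy.
have sm l (B : 'M[R]_(l, m)) : smooth_on O (fun y => B *m 'J phi y).
  apply: smooth_mulmx oO _ (smooth_jacobian oO sphi); exact: smooth_cst.
have dm l (B : 'M[R]_(l, m)) : differentiable (fun y => B *m 'J phi y) y.
  exact: smooth_diff (sm l B) Oy.
have -> : 'D_u ('D_(row b A) phi) y = 'D_u (fun y => row b A *m 'J phi y) y.
  apply: near_eq_derive; apply: filterS (open_nbhs_nbhs (conj oO Oy)) => z Oz.
  apply: deriveEjacobian; exact: smooth_diff sphi Oz.
apply/rowP => j; rewrite mxE.
apply: etrans (derive_mxE u b j (dm _ A)) _.
apply: etrans _ (esym (derive_mxE u 0 j (dm _ (row b A)))).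
have -> // : (fun z => (A *m 'J phi z) b j : R^o) = (fun z => (row b A *m 'J phi z) 0 j : R^o).
by apply/funext => z; rewrite !mxE; apply: eq_bigr => l _; rewrite !mxE.
Qed.

(* The second derivatives of [phi] cancel in pairs. *)
Lemma local_extd_pullback k (O O' : set 'rV[R]_m) (alpha : 'rV[R]_m -> 'M[R]_(k, m) -> R)
    (phi : 'rV[R]_m -> 'rV[R]_m) y (v : 'M[R]_(k.+1, m)) :
  open O -> open O' -> (forall y, O y -> O' (phi y)) ->
  (forall y, O' y -> alternating_multilinear (alpha y)) ->
  (forall v, smooth_on O' (fun y => alpha y v : R^o)) ->
  smooth_on O phi -> O y ->
  local_extd (fun y v => alpha (phi y) (v *m 'J phi y)) y v =
  local_extd alpha (phi y) (v *m 'J phi y).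
Proof.
move=> oO oO' pO alt sa sphi Oy.
have sJ := smooth_jacobian oO sphi.
have [W WE] : exists W, W = v *m 'J phi y by exists (v *m 'J phi y).
pose h a c := 'D_(row a v) ('D_(row c v) phi) y.
have hC a c : h a c = h c a.
  apply/rowP => j; rewrite /h.
  have sD u : smooth_on O ('D_u phi) by exact: smooth_derive.
  have dD u : differentiable ('D_u phi) y by exact: smooth_diff (sD u) Oy.
  have E u u' : ('D_u ('D_u' phi) y) 0 j = 'D_u ('D_u' (fun z => phi z 0 j : R^o)) y.
    apply: etrans (derive_mxE u 0 j (dD u')) _.
    apply: near_eq_derive; apply: filterS (open_nbhs_nbhs (conj oO Oy)) => z Oz.
    by apply: derive_mxE; exact: smooth_diff Oz.
  apply: etrans (E _ _) _; apply: etrans _ (esym (E _ _)).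
  by apply: (derive_comm _ _ oO) => //; exact: smooth_coord.
(* Differentiating row [c] of [W] in the direction [row a v] yields [h a c]. The same vector is
   written into row [a], which [row' a] deletes: the value is unchanged, and the matrix becomes
   symmetric in [a] and [c] with two equal rows, as [alt_row'_swap] wants. *)
pose T (a c : 'I_k.+1) : R := (-1) ^+ a *
  alpha (phi y) (row' a (setrow a (h a c) (setrow c (h a c) W))).
have DE a : 'D_(row a v) (fun y' => alpha (phi y') (row' a v *m 'J phi y') : R^o) y =
    'D_(row a W) (fun z => alpha z (row' a W) : R^o) (phi y) +
    \sum_b alpha (phi y)
      (row' a (setrow a (h a (lift a b)) (setrow (lift a b) (h a (lift a b)) W))).
  have sX : smooth_on O (fun y => row' a v *m 'J phi y).
    by apply: smooth_mulmx => //; exact: smooth_cst.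
  have -> : \sum_b alpha (phi y)
        (row' a (setrow a (h a (lift a b)) (setrow (lift a b) (h a (lift a b)) W))) =
      \sum_b alpha (phi y) (setrow b (h a (lift a b)) (row' a W)).
    by apply: eq_bigr => b _; rewrite row'_setrow.
  have ml z : O' z -> multilinear (alpha z) by move=> O'z; exact/alt_ml/alt.
  have dphi : 'D_(row a v) phi y = row a W.
    by rewrite WE row_mul; apply: deriveEjacobian; exact: smooth_diff sphi Oy.
  have AE : row' a v *m 'J phi y = row' a W.
    by rewrite WE; apply/row_matrixP => i; rewrite row_row' !row_mul row_row'.
  apply: (derive_family_eq oO oO' pO ml sa sphi sX Oy dphi AE) => b.
  rewrite /h -[row (lift a b) v]row_row'.
  exact: row_derive_mulJ oO sphi Oy.
rewrite -WE /local_extd; under eq_bigr => a _ do rewrite DE mulrDr mulr_sumr.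
rewrite big_split /= -[RHS]addr0; congr (_ + _).
have : \sum_a \sum_(c | c != a) T a c = 0.
  apply: sum_swap0 => a c ac; rewrite /T (hC c a).
  set N := setrow a _ _.
  have -> : setrow c (h a c) (setrow a (h a c) W) = N.
    apply/row_matrixP => i; rewrite !row_setrow.
    by have [->|_] := eqVneq i c; [case: eqP|].
  apply: alt_row'_swap => //; first exact/alt/pO.
  by rewrite /N !row_setrow !eqxx eq_sym (negbTE ac).
move=> T0; rewrite -[RHS]T0; apply: eq_bigr => a _.
by rewrite big_lift.
Qed.

End Naturality.

(** * Jacobian matrices and the chain rule *)

Section Jacobian.
Variable R : realType.

Lemma eq_lin1_mx k m (f g : 'rV[R]_k -> 'rV[R]_m) : f =1 g -> lin1_mx f = lin1_mx g.
Proof. by move=> E; apply/matrixP => i j; rewrite !mxE E. Qed.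

(** With the pullback formula in this form, functoriality of pullbacks becomes associativity of the
    matrix product. *)
Lemma mul_jacobian k m l (f : 'rV[R]_m -> 'rV[R]_l) y (v : 'M[R]_(k, m)) :
  \matrix_(a < k) ('d f y (row a v)) = v *m 'J f y.
Proof.
by apply/row_matrixP => a; rewrite rowK row_mul /jacobian mul_rV_lin1.
Qed.

Lemma jacobian_comp k m l (f : 'rV[R]_k -> 'rV[R]_m) (g : 'rV[R]_m -> 'rV[R]_l) y :
  differentiable f y -> differentiable g (f y) ->
  'J (g \o f) y = 'J f y *m 'J g (f y).
Proof.
move=> df dg; apply/row_matrixP => a; rewrite rowE [RHS]rowE mulmxA.
by rewrite /jacobian !mul_rV_lin1 diff_comp.
Qed.

Lemma near_eq_jacobian k m (f g : 'rV[R]_k -> 'rV[R]_m) y :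
  (\near y, f y = g y) -> differentiable f y -> 'J g y = 'J f y.
Proof.
move=> fg df; have [_ E] := differentiable_near_eq fg df.
by apply: eq_lin1_mx => u; exact: (congr1 (fun h => h u) E).
Qed.

Lemma jacobian_chain k m l (f : 'rV[R]_k -> 'rV[R]_m) (g : 'rV[R]_m -> 'rV[R]_l)
    (h : 'rV[R]_k -> 'rV[R]_l) y z : f y = z ->
  differentiable f y -> differentiable g z -> (\forall x \near y, g (f x) = h x) ->
  'J f y *m 'J g z = 'J h y.
Proof.
move=> <- df dg gfh; apply: etrans (esym (jacobian_comp df dg)) _.
by apply/esym; exact: (near_eq_jacobian gfh (differentiable_comp df dg)).
Qed.

Lemma jacobian_id m (y : 'rV[R]_m) : 'J idfun y = 1%:M.
Proof.
apply/row_matrixP => a; rewrite rowE [RHS]rowE mulmx1 /jacobian mul_rV_lin1.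
by rewrite (@diff_lin _ _ _ idfun) // => x; exact: cvg_id.
Qed.

End Jacobian.

(** * Forms and ideals along a diffeomorphism *)

Lemma open_setI_preimage (T S : topologicalType) (A : set T) (B : set S) (f : T -> S) :
  open A -> open B -> (forall x, A x -> {for x, continuous f}) ->
  open (A `&` f @^-1` B).
Proof.
move=> oA oB cf; rewrite openE => x [Ax Bfx].
apply: filterI; first exact: open_nbhs_nbhs.
by apply: cf => //; exact: open_nbhs_nbhs.
Qed.

Section Charts.
Variables (R : realType) (m : nat) (M : manifold R m).

Lemma dom_cover (p : M) : exists i, dom i p.
Proof. by case: M p. Qed.

Lemma dom_open (i : idx M) : open (dom i).
Proof. by case: M i. Qed.

Lemma chartK (i : idx M) p : dom i p -> param i (chart i p) = p.
Proof. by case: M i p. Qed.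

Lemma param_continuous (i : idx M) p : dom i p -> {for chart i p, continuous (param i)}.
Proof.
by case: M i p => C I d c q H1 H2 H3 H4 H5 H6 H7 H8 H9 i p dp;
  refine (H8 i _ _); exists p.
Qed.

Lemma transition_smooth (i j : idx M) :
  smooth_on (chart i @` (dom i `&` dom j)) (chart j \o param i).
Proof. by case: M i j. Qed.

Lemma chart_image_open N (i : idx M) : open N -> open (chart i @` (N `&` dom i)).
Proof.
move=> oN; have oI : open (chart i @` dom i) by case: M i {N oN}.
suff -> : chart i @` (N `&` dom i) = chart i @` dom i `&` param i @^-1` N.
  by apply: open_setI_preimage => // _ [p dp <-]; exact: param_continuous.
apply/seteqP; split=> [_ [p [Np dp] <-]|_ [[p dp <-]]].
  by split; [exists p|rewrite /= chartK].
by rewrite /= chartK // => Np; exists p.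
Qed.

Lemma near_chart N (i : idx M) p (P : 'rV[R]_m -> Prop) : open N -> N p -> dom i p ->
  (forall q, N q -> dom i q -> P (chart i q)) -> \forall y \near chart i p, P y.
Proof.
move=> oN Np dp H.
have oC := @chart_image_open N i oN.
have Cp : (chart i @` (N `&` dom i)) (chart i p) by exists p.
by apply: filterS (open_nbhs_nbhs (conj oC Cp)) => _ [q [Nq dq] <-]; exact: H.
Qed.

Lemma transition_differentiable (i j : idx M) p :
  dom i p -> dom j p -> differentiable (chart j \o param i) (chart i p).
Proof. by move=> di dj; apply: smooth_diff (@transition_smooth i j) _; exists p. Qed.

Lemma form_eq_near_refl p k (alpha : mform M k) : form_eq_near p alpha alpha.
Proof. by exists setT; split=> //; exact: openT. Qed.

Lemma form_eq_near_sym p k (alpha beta : mform M k) :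
  form_eq_near p alpha beta -> form_eq_near p beta alpha.
Proof. by case=> W [oW Wp E]; exists W; split=> // q i Wq dq v; rewrite E. Qed.

Lemma form_eq_near_trans p k (alpha beta gamma : mform M k) :
  form_eq_near p alpha beta -> form_eq_near p beta gamma -> form_eq_near p alpha gamma.
Proof.
move=> [W [oW Wp E]] [W' [oW' Wp' E']]; exists (W `&` W').
by split=> //; [exact: openI|move=> q i [Wq W'q] dq v; rewrite E // E'].
Qed.

Lemma form_near_germ p k (alpha beta : mform M k) :
  form_eq_near p alpha beta -> form_near p alpha -> form_near p beta.
Proof.
move=> [W [oW Wp E]] [W' [oW' Wp' [Fa Fs Fc]]].
exists (W `&` W'); split=> //; first exact: openI.
split=> [q i [Wq W'q] dq|i v|q i j [Wq W'q] di dj v].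
- have -> : beta i (chart i q) = alpha i (chart i q) by apply/funext => v; rewrite E.
  exact: Fa.
- apply: (@eq_smooth _ _ _ _ (fun y => alpha i y v : R^o)).
  + by apply: chart_image_open; exact: openI.
  + by move=> _ [q [[Wq W'q] dq] <-]; exact: E.
  + by apply: sub_smooth (Fs i v) => _ [q [[Wq W'q] dq] <-]; exists q.
- by rewrite -!E // (Fc q i j).
Qed.

Lemma form_eq_near_extd p k (alpha beta : mform M k) :
  form_eq_near p alpha beta -> form_eq_near p (extd alpha) (extd beta).
Proof.
move=> [W [oW Wp E]]; exists W; split=> // q i Wq dq v.
apply: eq_bigr => a _; congr (_ * _); apply: near_eq_derive.
by apply: (near_chart oW) => // q' Wq' dq'; exact: E.
Qed.

Lemma sub_is_form (W W' : set M) k (alpha : mform M k) :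
  W' `<=` W -> is_form W alpha -> is_form W' alpha.
Proof.
move=> sW [Fa Fs Fc]; split=> [q i /sW|i v|q i j /sW Wq].
- exact: Fa.
- by apply: sub_smooth (Fs i v) => _ [q [/sW Wq dq] <-]; exists q.
- exact: Fc.
Qed.

End Charts.

Lemma alt_mulr (R : realType) m k l (phi : 'M[R]_(k, m) -> R) (J : 'M[R]_(l, m)) :
  alternating_multilinear phi -> alternating_multilinear (fun v : 'M[R]_(k, l) => phi (v *m J)).
Proof.
move=> H; apply: alternatingP => [A B C a b c E EB EC|A a b ab E].
  apply: (@alt_ml _ _ _ _ H _ _ _ a).
  - by rewrite !row_mul E mulmxDl !scalemxAl.
  - by move=> i ia; rewrite !row_mul EB.
  - by move=> i ia; rewrite !row_mul EC.
by apply: (H.2 _ a b) => //; rewrite !row_mul E.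
Qed.

Section Euclid.
Variables (R : realType) (m : nat).
Notation Rm := (euclid R m).

(** The only change of coordinates is the identity, whose Jacobian is 1, so compatibility holds
    automatically. *)
Lemma euclid_is_form (W : set Rm) k (alpha : mform Rm k) :
  is_form W alpha <->
  (forall y : 'rV[R]_m, W y -> alternating_multilinear (alpha tt y)) /\
  (forall v, smooth_on (W : set 'rV[R]_m) (fun y => alpha tt y v : R^o)).
Proof.
have WE : [set idfun x | x in W `&` setT] = (W : set 'rV[R]_m).
  by rewrite setIT image_id.
split=> [[Fa Fs Fc]|[Fa Fs]].
  split=> [y Wy|v]; first exact: (Fa y tt).
  by have := Fs tt v; rewrite WE.
split=> [y [] Wy _|[] v|y [] [] Wy _ _ v]; first exact: Fa.
  by rewrite /= WE.
by rewrite mul_jacobian jacobian_id mulmx1.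
Qed.

End Euclid.

Section Transfer.
Variables (R : realType) (m : nat) (M : manifold R m).
Notation Rm := (euclid R m).
Variables (N : set M) (U : set 'rV[R]_m) (Phi : M -> 'rV[R]_m) (Psi : 'rV[R]_m -> M).
Variable (i0 : idx M).
Hypothesis Ndom : N `<=` dom i0.
Hypothesis dPhi : @diffeo R m M Rm N U Phi Psi.

Let oN : open N. Proof. by case: dPhi => -[]. Qed.
Let oU : open U. Proof. by case: dPhi => -[]. Qed.
Let PhiK p : N p -> Psi (Phi p) = p.
Proof. by case: dPhi => _ _ _ H _ /H[]. Qed.
Let PhiU p : N p -> U (Phi p).
Proof. by case: dPhi => _ _ _ H _ /H[]. Qed.
Let PsiK q : U q -> Phi (Psi q) = q.
Proof. by case: dPhi => _ _ _ _ H /H[]. Qed.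
Let PsiN q : U q -> N (Psi q).
Proof. by case: dPhi => _ _ _ _ H /H[]. Qed.
Let Phi_cont p : N p -> {for p, continuous Phi}.
Proof. by case: dPhi => _ [H _] _ _ _; exact: H. Qed.
Let Psi_cont q : U q -> {for q, continuous Psi}.
Proof. by case: dPhi => _ _ [H _] _ _; exact: H. Qed.

Let phi i : 'rV[R]_m -> 'rV[R]_m := Phi \o param i.
Let psi : 'rV[R]_m -> 'rV[R]_m := chart i0 \o Psi.

Let phi_smooth i : smooth_on (chart i @` (N `&` dom i)) (phi i).
Proof.
case: dPhi => _ [_ H] _ _ _; have := H i tt.
by rewrite preimage_setT setIT.
Qed.

Let psi_smooth : smooth_on U psi.
Proof.
case: dPhi => _ _ [_ H] _ _; have := H tt i0.
have -> : @chart R m Rm tt @` (U `&` @dom R m Rm tt `&` Psi @^-1` dom i0) = U.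
  rewrite [LHS]image_id setIT; apply/seteqP; split=> [q []//|q Uq].
  by split=> //; exact/Ndom/PsiN.
by [].
Qed.

Let phi_diff i p : N p -> dom i p -> differentiable (phi i) (chart i p).
Proof. by move=> Np dp; apply: smooth_diff (@phi_smooth i) _; exists p. Qed.

Let psi_diff q : U q -> differentiable psi q.
Proof. by move=> Uq; exact: smooth_diff psi_smooth Uq. Qed.

Let phiE i p : dom i p -> phi i (chart i p) = Phi p.
Proof. by move=> dp; rewrite /phi /= chartK. Qed.

Definition Pull k (alpha : mform Rm k) : mform M k :=
  fun i y v => alpha tt (phi i y) (v *m 'J (phi i) y).

Definition Push k (beta : mform M k) : mform Rm k :=
  fun _ y v => beta i0 (psi y) (v *m 'J psi y).

Lemma jacobian_push_pull q : U q -> 'J psi q *m 'J (phi i0) (psi q) = 1%:M.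
Proof.
move=> Uq; have Nq := PsiN Uq; have dq := Ndom Nq.
rewrite -(jacobian_id q).
apply: jacobian_chain (erefl _) (psi_diff Uq) (phi_diff Nq dq) _.
apply: filterS (open_nbhs_nbhs (conj oU Uq)) => z Uz.
by rewrite /= phiE ?PsiK //; exact/Ndom/PsiN.
Qed.

Let J_phi_psi i p : N p -> dom i p ->
  'J (phi i) (chart i p) *m 'J psi (Phi p) = 'J (chart i0 \o param i) (chart i p).
Proof.
move=> Np dp.
apply: jacobian_chain (phiE dp) (phi_diff Np dp) (psi_diff (PhiU Np)) _.
apply: (near_chart oN) => // q Nq dq.
by rewrite phiE // /psi /= PhiK // chartK.
Qed.

Let J_phi_trans i j p : N p -> dom i p -> dom j p ->
  'J (chart j \o param i) (chart i p) *m 'J (phi j) (chart j p) = 'J (phi i) (chart i p).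
Proof.
move=> Np di dj.
have E : (chart j \o param i) (chart i p) = chart j p by rewrite /= chartK.
apply: jacobian_chain E (transition_differentiable di dj) (phi_diff Np dj) _.
have oNj : open (N `&` dom j) by apply: openI => //; exact: dom_open.
apply: (near_chart oNj) => // q [Nq djq] dq.
by rewrite phiE //= chartK // phiE.
Qed.

Lemma is_pullback_Pull k (alpha : mform Rm k) :
  @is_pullback R m M Rm N Phi k alpha (Pull alpha).
Proof.
move=> p i [] Np dp _ v; rewrite mul_jacobian.
by rewrite /Pull phiE.
Qed.

Lemma Pull_germ p k (alpha beta : mform Rm k) : N p ->
  form_eq_near (Phi p : Rm) alpha beta -> form_eq_near p (Pull alpha) (Pull beta).
Proof.
move=> Np [W [oW Wp E]]; exists (N `&` Phi @^-1` W); split=> //.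
  exact: open_setI_preimage.
by move=> q i [Nq Wq] dq v; rewrite /Pull phiE //; exact: E.
Qed.

Lemma Push_germ q k (alpha beta : mform M k) : U q ->
  form_eq_near (Psi q) alpha beta -> form_eq_near (q : Rm) (Push alpha) (Push beta).
Proof.
move=> Uq [W [oW Wp E]]; exists (U `&` Psi @^-1` W); split=> //.
  exact: (@open_setI_preimage Rm).
move=> q' [] [Uq' Wq'] _ v; rewrite /Push /psi /= E //.
exact/Ndom/PsiN.
Qed.

Lemma form_near_Pull p k (alpha : mform Rm k) : N p ->
  form_near (Phi p : Rm) alpha -> form_near p (Pull alpha).
Proof.
move=> Np [W [oW Wp /euclid_is_form[Fa Fs]]].
pose W' := N `&` Phi @^-1` W.
have oW' : open W' by exact: open_setI_preimage.
exists W'; split; [exact: oW'|by []|].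
split=> [q i [Nq Wq] dq|i v|q i j [Nq Wq] di dj v].
- rewrite /Pull (phiE dq); apply: alt_mulr; exact: Fa.
- pose O := chart i @` (W' `&` dom i).
  have oO : open O by exact: chart_image_open.
  have sphi : smooth_on O (phi i).
    by apply: sub_smooth (@phi_smooth i) => _ [q [[Nq _] dq] <-]; exists q.
  apply: (@smooth_family _ _ _ _ O W (alpha tt) (phi i) (fun y => v *m 'J (phi i) y) oO oW).
  + by move=> _ [q [[_ Wq] dq] <-]; rewrite (phiE dq).
  + by move=> y Wy; exact/alt_ml/Fa.
  + exact: Fs.
  + exact: sphi.
  + by apply: (smooth_mulmx oO _ (smooth_jacobian oO sphi)); exact: smooth_cst.
- rewrite mul_jacobian /Pull (phiE di) (phiE dj) -mulmxA.
  by rewrite (J_phi_trans Nq di dj).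
Qed.

Lemma form_near_Push q k (beta : mform M k) : U q ->
  form_near (Psi q) beta -> form_near (q : Rm) (Push beta).
Proof.
move=> Uq [W [oW Wp [Fa Fs _]]].
pose W' : set 'rV[R]_m := U `&` Psi @^-1` W.
have oW' : open W' by exact: open_setI_preimage.
have W'O y : W' y -> (chart i0 @` (W `&` dom i0)) (psi y).
  by move=> [Uy Wy]; exists (Psi y) => //; split=> //; exact/Ndom/PsiN.
have alt z : (chart i0 @` (W `&` dom i0)) z -> alternating_multilinear (beta i0 z).
  by move=> [p [Wp' dp] <-]; exact: Fa.
exists W'; split; [exact: oW'|by []|].
apply/euclid_is_form; split=> [y W'y|v].
  by apply: alt_mulr; exact/alt/W'O.
have spsi : smooth_on W' psi by apply: sub_smooth psi_smooth => y [].
apply: (@smooth_family _ _ _ _ W' (chart i0 @` (W `&` dom i0)) (beta i0) psi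
  (fun y => v *m 'J psi y) oW' _ W'O).
- exact: chart_image_open.
- by move=> y Wy; exact/alt_ml/alt.
- exact: Fs.
- exact: spsi.
- by apply: (smooth_mulmx oW' _ (smooth_jacobian oW' spsi)); exact: smooth_cst.
Qed.

Lemma Push_Pull q k (gamma : mform Rm k) : U q ->
  form_eq_near (q : Rm) (Push (Pull gamma)) gamma.
Proof.
move=> Uq; exists U; split=> // y [] Uy _ v.
rewrite /Push /Pull -mulmxA (jacobian_push_pull Uy) mulmx1.
by rewrite /psi /= (phiE (Ndom (PsiN Uy))) (PsiK Uy).
Qed.

(** [Push] retains only the local expression of [beta] in the chart [i0]; the others are recovered
    from it through [form_compatible], hence the hypothesis that [beta] is a form near [p]. *)
Lemma Pull_Push p k (beta : mform M k) : N p -> form_near p beta ->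
  form_eq_near p (Pull (Push beta)) beta.
Proof.
move=> Np [W [oW Wp [_ _ Fc]]]; exists (N `&` W); split=> //; first exact: openI.
move=> q i [Nq Wq] dq v.
rewrite (Fc q i i0 Wq dq (Ndom Nq)) mul_jacobian /Pull /Push (phiE dq) -mulmxA.
by rewrite (J_phi_psi Nq dq) /psi /= (PhiK Nq).
Qed.

Lemma Pull_wedge k l (alpha : mform Rm k) (beta : mform Rm l) :
  Pull (wedge alpha beta) = wedge (Pull alpha) (Pull beta).
Proof.
apply/funext => i; apply/funext => y; apply/funext => v.
rewrite /Pull /wedge; congr (_ * _); apply: eq_bigr => s _; congr (_ * (_ * _)).
  by rewrite mul_usub_mx !row_permE mulmxA.
by rewrite mul_dsub_mx !row_permE mulmxA.
Qed.

Lemma Push_wedge k l (alpha : mform M k) (beta : mform M l) :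
  Push (wedge alpha beta) = wedge (Push alpha) (Push beta).
Proof.
apply/funext => i; apply/funext => y; apply/funext => v.
rewrite /Push /wedge; congr (_ * _); apply: eq_bigr => s _; congr (_ * (_ * _)).
  by rewrite mul_usub_mx !row_permE mulmxA.
by rewrite mul_dsub_mx !row_permE mulmxA.
Qed.

Lemma Pull_extd p k (alpha : mform Rm k) : N p -> form_near (Phi p : Rm) alpha ->
  form_eq_near p (extd (Pull alpha)) (Pull (extd alpha)).
Proof.
move=> Np [W [oW Wp /euclid_is_form[Fa Fs]]].
pose W' := N `&` Phi @^-1` W.
have oW' : open W' by exact: open_setI_preimage.
exists W'; split=> // q i W'q dq v.
have oO := @chart_image_open _ _ _ _ i oW'.
apply: (@local_extd_pullback _ _ _ _ W (alpha tt) (phi i) (chart i q) v oO) => //.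
- by move=> _ [q' [[_ Wq'] dq'] <-]; rewrite phiE.
- by apply: sub_smooth (@phi_smooth i) => _ [q' [[Nq _] dq'] <-]; exists q'.
- by exists q.
Qed.

Lemma Push_extd q k (beta : mform M k) : U q -> form_near (Psi q) beta ->
  form_eq_near (q : Rm) (extd (Push beta)) (Push (extd beta)).
Proof.
move=> Uq [W [oW Wp [Fa Fs _]]].
pose W' : set 'rV[R]_m := U `&` Psi @^-1` W.
have oW' : open W' by exact: open_setI_preimage.
exists W'; split=> // y [] W'y _ v.
apply: (@local_extd_pullback _ _ _ W' (chart i0 @` (W `&` dom i0)) (beta i0) psi y v) => //.
- exact: chart_image_open.
- by move=> z [Uz Wz]; exists (Psi z) => //; split=> //; exact/Ndom/PsiN.
- by move=> _ [p [Wp' dp] <-]; exact: Fa.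
- by apply: sub_smooth psi_smooth => z [].
Qed.

Lemma ideal_Pull p (J : forall k, mform M k -> Prop) : N p -> is_ideal p J ->
  is_ideal (Phi p : Rm) (fun k gamma => J k (Pull gamma)).
Proof.
move=> Np JI; have Up := PhiU Np; split.
- move=> k gamma /(ideal_form JI) F.
  (* Membership in [J] gives regularity of [Pull gamma] only; [gamma] is recovered near the point as
     the push forward of that form. *)
  apply: form_near_germ (Push_Pull gamma Up) _.
  by apply: form_near_Push => //; rewrite PhiK.
- by move=> k alpha beta E; apply: (ideal_germ JI); exact: Pull_germ.
- by move=> k; exact: (ideal_0 JI).
- by move=> k alpha beta; exact: (ideal_add JI).
- move=> k l beta alpha F Ja; rewrite Pull_wedge.
  by apply: (ideal_wedgel JI) => //; exact: form_near_Pull.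
- move=> k l beta alpha F Ja; rewrite Pull_wedge.
  by apply: (ideal_wedger JI) => //; exact: form_near_Pull.
Qed.

Lemma form_eq_near_wedge (M' : manifold R m) (p : M') k l (a a' : mform M' k) (b b' : mform M' l) :
  form_eq_near p a a' -> form_eq_near p b b' -> form_eq_near p (wedge a b) (wedge a' b').
Proof.
move=> [W [oW Wp E]] [W' [oW' Wp' E']]; exists (W `&` W'); split=> //; first exact: openI.
move=> q i [Wq W'q] dq v; rewrite /wedge; congr (_ * _); apply: eq_bigr => s _.
by rewrite E // E'.
Qed.

(* [Push] only reads [beta] in the chart [i0]; the second conjunct says that the
   other local expressions of [beta] are compatible with this one. *)
Lemma ideal_Push p (J : forall k, mform Rm k -> Prop) : N p -> is_ideal (Phi p : Rm) J ->
  is_ideal p (fun k beta => J k (Push beta) /\ form_eq_near p (Pull (Push beta)) beta).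
Proof.
move=> Np JI; have Up := PhiU Np; split.
- move=> k beta [/(ideal_form JI) F E].
  by apply: form_near_germ E _; exact: form_near_Pull.
- move=> k alpha beta E [Ja Ea].
  have E' : form_eq_near (Phi p : Rm) (Push alpha) (Push beta).
    by apply: Push_germ => //; rewrite PhiK.
  split; first exact: (ideal_germ JI) E' Ja.
  apply: form_eq_near_trans E; apply: form_eq_near_trans Ea.
  by apply: form_eq_near_sym; exact: Pull_germ.
- by move=> k; split; [exact: (ideal_0 JI)|exact: form_eq_near_refl].
- move=> k alpha beta [Ja [W [oW Wp E]]] [Jb [W' [oW' Wp' E']]]; split.
    exact: (ideal_add JI) Ja Jb.
  exists (W `&` W'); split=> //; first exact: openI.
  by move=> q i [Wq W'q] dq v; rewrite /addf -E // -E'.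
- move=> k l beta alpha F [Ja Ea]; split.
    rewrite Push_wedge; apply: (ideal_wedgel JI) => //.
    by apply: form_near_Push => //; rewrite PhiK.
  by rewrite Push_wedge Pull_wedge; apply: form_eq_near_wedge => //; exact: Pull_Push.
- move=> k l alpha beta F [Ja Ea]; split.
    rewrite Push_wedge; apply: (ideal_wedger JI) => //.
    by apply: form_near_Push => //; rewrite PhiK.
  by rewrite Push_wedge Pull_wedge; apply: form_eq_near_wedge => //; exact: Pull_Push.
Qed.

End Transfer.

(** * Ideals of forms on a Euclidean space *)

Section FormAlgebra.
Variables (R : realType) (m : nat).
Notation Rm := (euclid R m).
Implicit Types (q : Rm).

Definition scalef (f : 'rV[R]_m -> R) k (alpha : mform Rm k) : mform Rm k :=
  fun i y v => f y * alpha i y v.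

Definition dfun (f : 'rV[R]_m -> R) : mform Rm 1 :=
  fun i y v => 'D_v (f : 'rV[R]_m -> R^o) y.

Lemma form_eq_nearP (O : set 'rV[R]_m) q k (alpha beta : mform Rm k) :
  open O -> O q -> (forall y, O y -> forall v, alpha tt y v = beta tt y v) ->
  form_eq_near q alpha beta.
Proof. by move=> oO Oq E; exists O; split=> // y [] Oy _ v; exact: E. Qed.

Lemma form_nearP q k (alpha : mform Rm k) : form_near q alpha ->
  exists O : set 'rV[R]_m, [/\ open O, O q,
    forall y, O y -> alternating_multilinear (alpha tt y) &
    forall v, smooth_on O (fun y => alpha tt y v : R^o)].
Proof. by move=> [W [oW Wq /euclid_is_form[Fa Fs]]]; exists W. Qed.

Lemma form_near_of (O : set 'rV[R]_m) q k (alpha : mform Rm k) :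
  open O -> O q -> (forall y, O y -> alternating_multilinear (alpha tt y)) ->
  (forall v, smooth_on O (fun y => alpha tt y v : R^o)) -> form_near q alpha.
Proof. by move=> oO Oq Fa Fs; exists O; split=> //; apply/euclid_is_form. Qed.

(** The sign of each permutation is cancelled by the alternation of [alpha], leaving [k!] equal
    terms against the normalising factor. *)
Lemma wedge0E (f : 'rV[R]_m -> R) k (alpha : mform Rm k) i y v :
  alternating_multilinear (alpha i y) ->
  wedge ((fun _ y _ => f y) : mform Rm 0) alpha i y v = f y * alpha i y v.
Proof.
move=> Fa; rewrite /wedge mul1n.
have -> : \sum_(s : 'S_(0 + k)) (-1) ^+ s * (f y * alpha i y (dsubmx (row_perm s v))) =
  \sum_(s : 'S_k) f y * alpha i y v.
  apply: eq_bigr => s _.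
  have -> : dsubmx (row_perm s v : 'M[R]_(0 + k, m)) = row_perm s v.
    by apply/matrixP => a b; rewrite !mxE; congr (v (s _) _); exact: val_inj.
  by rewrite alt_perm // [X in _ * X]mulrCA [LHS]mulrA -signr_addb addbb mul1r.
rewrite sumr_const card_Sn -[X in _ * X]mulr_natl mulKf //.
Qed.

Lemma form_near_dfun (O : set 'rV[R]_m) (f : 'rV[R]_m -> R) q :
  open O -> smooth_on O (f : 'rV[R]_m -> R^o) -> O q -> form_near q (dfun f).
Proof.
move=> oO sf Oq; apply: (form_near_of oO Oq) => [y Oy|v]; last exact: smooth_derive.
have dfy : differentiable (f : 'rV[R]_m -> R^o) y by exact: smooth_diff Oy.
apply: alternatingP => [A B C a b c E EB EC|A a b].
  move: E; rewrite (ord1 a) !row_id => ->.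
  by rewrite /dfun !deriveE // linearD !linearZ.
by rewrite (ord1 a) (ord1 b) eqxx.
Qed.

Section Ideal.
Variables (q : Rm) (J : forall k, mform Rm k -> Prop).
Hypothesis JI : is_ideal q J.

(** Multiplication by a function is the wedge product with a 0-form, under which ideals are
    closed. *)
Lemma ideal_scale (O : set 'rV[R]_m) (f : 'rV[R]_m -> R) k (alpha : mform Rm k) :
  open O -> O q -> smooth_on O (f : 'rV[R]_m -> R^o) -> J alpha -> J (scalef f alpha).
Proof.
move=> oO Oq sf Ja.
have [W [oW Wq Fa Fs]] := form_nearP (ideal_form JI Ja).
have F0 : form_near q ((fun _ y _ => f y) : mform Rm 0).
  by apply: (form_near_of oO Oq) => // y Oy; split=> [A B C []|A []].
apply: (ideal_germ JI) _ (ideal_wedgel JI F0 Ja).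
by apply: (form_eq_nearP oW Wq) => y Wy v; rewrite wedge0E //; exact: Fa.
Qed.

Lemma ideal_sub k (alpha beta : mform Rm k) : J alpha -> J beta -> J (subf alpha beta).
Proof.
move=> Ja Jb.
have Jn : J (scalef (fun=> -1) beta).
  by apply: (@ideal_scale setT) => //; [exact: openT|exact: smooth_cst].
apply: (ideal_germ JI) _ (ideal_add JI Ja Jn).
by apply: (form_eq_nearP openT) => // y _ v; rewrite /addf /subf /scalef mulN1r.
Qed.

(** The Leibniz rule for [f alpha]: [wedge1E] expands the product of [df] with [alpha] over the same
    index as [extd], so the two sides match term by term. *)
Lemma ideal_extd_scale (O : set 'rV[R]_m) (f : 'rV[R]_m -> R) k (alpha : mform Rm k) :
  open O -> O q -> smooth_on O (f : 'rV[R]_m -> R^o) ->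
  J alpha -> J (extd alpha) -> J (extd (scalef f alpha)).
Proof.
move=> oO Oq sf Ja Jda.
have [W [oW Wq Fa Fs]] := form_nearP (ideal_form JI Ja).
have Fdf := form_near_dfun oO sf Oq.
have J1 : J (wedge (dfun f) alpha) := ideal_wedgel JI Fdf Ja.
have J2 : J (scalef f (extd alpha)) by exact: ideal_scale Oq sf Jda.
apply: (ideal_germ JI) _ (ideal_add JI J1 J2).
apply: (@form_eq_nearP (O `&` W)) => [||y [Oy Wy] v]; [exact: openI|by []|].
rewrite /addf /scalef (wedge1E _ _ (Fa y Wy)) /extd mulr_sumr -big_split /=.
apply: eq_bigr => a _.
have df : derivable (f : 'rV[R]_m -> R^o) y (row a v).
  by apply: diff_derivable; exact: smooth_diff sf Oy.
have da : derivable (fun y' => alpha tt y' (row' a v) : R^o) y (row a v).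
  by apply: diff_derivable; exact: smooth_diff (Fs _) Wy.
have -> : 'D_(row a v) (fun y' => f y' * alpha tt y' (row' a v) : R^o) y =
   f y * 'D_(row a v) (fun y' => alpha tt y' (row' a v) : R^o) y +
   alpha tt y (row' a v) * 'D_(row a v) (f : 'rV[R]_m -> R^o) y.
  exact: (deriveM df da).
by rewrite mulrDr addrC mulrCA /dfun [alpha _ _ _ * _]mulrC.
Qed.

End Ideal.

End FormAlgebra.

(** * The standard Lagrangian pair *)

Section Standard.
Variables (R : realType) (n : nat).
Notation m := (dim2n1 n).
Notation Rst := (euclid R m).
Implicit Types (y : 'rV[R]_m).

(** Expanding the wedge product with its first factor is the Laplace expansion of the determinant
    along the first column. *)
Lemma wedges_dcoord k (g : 'I_k -> 'I_m) i y (v : 'M[R]_(k, m)) :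
  wedges (fun a => @dcoord R n (g a)) i y v = \det (colsub g v).
Proof.
elim: k g v => [|k IH] g v; first by rewrite det_mx00.
transitivity (wedge (@dcoord R n (g ord0)) (wedges (fun b => @dcoord R n (g (lift ord0 b)))) i y v).
  by [].
rewrite wedge1E; last first.
  have -> : wedges (fun b => @dcoord R n (g (lift ord0 b))) i y =
     fun v => \det (colsub (fun b => g (lift ord0 b)) v) by apply/funext => w; exact: IH.
  exact: alt_det.
rewrite (expand_det_col _ ord0); apply: eq_bigr => a _.
rewrite IH /cofactor addn0 /dcoord !mxE mulrCA; congr (_ * (_ * \det _)).
by apply/matrixP => b c; rewrite !mxE.
Qed.

Lemma hesse_formE (F : 'rV[R]_m -> R) i y v :
  hesse_form F i y v = F y * \det (colsub (@ix n) v) - \det (colsub (@ip n) v).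
Proof. by rewrite /hesse_form /dx /dp !wedges_dcoord. Qed.

Lemma theta_stE i y v : @theta_st R n i y v = v 0 (@iz n) - \sum_a y 0 (ip a) * v 0 (ix a).
Proof. by []. Qed.

Lemma theta_st_lin i y (b c : R) u w :
  @theta_st R n i y (b *: u + c *: w) = b * theta_st i y u + c * theta_st i y w.
Proof.
rewrite !theta_stE !mxE !mulrBr !mulr_sumr addrACA -opprD -big_split /=; congr (_ - _).
by apply: eq_bigr => a _; rewrite !mxE mulrDr !(mulrCA _ (y _ _)).
Qed.

Lemma theta_st_alt i y : alternating_multilinear (@theta_st R n i y).
Proof.
apply: alternatingP => [A B C a b c E _ _|A a b]; last by rewrite (ord1 a) (ord1 b) eqxx.
by move: E; rewrite (ord1 a) !row_id => ->; exact: theta_st_lin.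
Qed.

Lemma smooth_entry (O : set 'rV[R]_m) j : open O -> smooth_on O (fun y => y 0 j : R^o).
Proof. by move=> oO; apply: (smooth_coord _ _ oO (@smooth_id R m O)). Qed.

Lemma theta_st_smooth (O : set 'rV[R]_m) v : open O ->
  smooth_on O (fun y => @theta_st R n tt y v : R^o).
Proof.
move=> oO; apply: smoothD => //; first exact: smooth_cst.
apply: smoothN => //; apply: smooth_sum => // a; apply: smoothM => //.
  exact: smooth_entry.
exact: smooth_cst.
Qed.

Lemma theta_st_form (O : set Rst) : open (O : set 'rV[R]_m) -> is_form O (@theta_st R n).
Proof.
move=> oO; apply/euclid_is_form; split=> [y _|v]; first exact: theta_st_alt.
exact: theta_st_smooth.
Qed.

Lemma hesse_form_form (O : set Rst) (F : 'rV[R]_m -> R) : open (O : set 'rV[R]_m) ->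
  smooth_on (O : set 'rV[R]_m) (F : 'rV[R]_m -> R^o) -> is_form O (hesse_form F).
Proof.
move=> oO sF; apply/euclid_is_form; split=> [y _|v].
  have -> : hesse_form F tt y =
      (fun v => \det (colsub (@ip n) v) * (-1) + F y * \det (colsub (@ix n) v)).
    by apply/funext => v; rewrite hesse_formE mulrN1 addrC.
  have D1 := @alt_det R n m (@ix n); have D2 := @alt_det R n m (@ip n).
  apply: alternatingP.
    have := ml_comb (-1) (F y) (alt_ml D2) (alt_ml D1).
    by under eq_fun do rewrite [-1 * _]mulrC.
  by move=> A a b ab E; rewrite (D1.2 A a b) // (D2.2 A a b) // mul0r mulr0 addr0.
under eq_fun do rewrite hesse_formE.
apply: smoothD => //; last exact: smooth_cst.
by apply: smoothM => //; exact: smooth_cst.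
Qed.

Lemma derive_theta_st y (u w : 'rV[R]_m) :
  'D_u (fun y => @theta_st R n tt y w : R^o) y = - \sum_a u 0 (ip a) * w 0 (ix a).
Proof.
pose L y : R^o := \sum_a y 0 (ip a) * w 0 (ix a).
have Ll : linear L.
  move=> c x z; rewrite /L scaler_sumr -big_split; apply: eq_bigr => a _ /=.
  by rewrite !mxE mulrDl -mulrA.
pose LM := GRing.isLinear.Build _ _ _ _ _ Ll.
pose LL : {linear _ -> _} := HB.pack L LM.
have dL (x : 'rV[R]_m) : differentiable L x.
  apply: (@smooth_diff _ _ _ setT) => //; apply: smooth_sum; first exact: openT.
  move=> a; apply: smoothM; [exact: openT|exact/smooth_entry/openT|exact: smooth_cst].
have cL : continuous LL by move=> x; exact: differentiable_continuous.
have -> : (fun y => @theta_st R n tt y w : R^o) = cst (w 0 (@iz n) : R^o) - L.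
  by apply/funext => z.
rewrite deriveB; [|exact: derivable_cst|exact: diff_derivable].
rewrite derive_cst sub0r deriveE //; congr (- _).
by have /= -> := diff_lin y cL.
Qed.

(** This is the sum of the [dx_a /\ dp_a], the sign coming from [d(-p_a dx_a) = - dp_a /\ dx_a]. *)
Lemma extd_theta_st y (u w : 'rV[R]_m) :
  extd (@theta_st R n) tt y (col_mx u w) =
  \sum_a (u 0 (ix a) * w 0 (ip a) - u 0 (ip a) * w 0 (ix a)).
Proof.
rewrite /extd big_ord_recl big_ord1 expr0 mul1r expr1 mulN1r !derive_theta_st opprK.
have r0 : row (ord0 : 'I_2) (col_mx u w) = u by rewrite (@row_col_mx0 _ _ 1).
have r1 : row (lift ord0 ord0 : 'I_2) (col_mx u w) = w.
  by rewrite (@row_col_mxS _ _ 1) row_id.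
have r0' : row' (ord0 : 'I_2) (col_mx u w) = w.
  by apply/row_matrixP => i; rewrite (ord1 i) row_row' r1 row_id.
have r1' : row' (lift ord0 ord0 : 'I_2) (col_mx u w) = u.
  apply/row_matrixP => i; rewrite (ord1 i) row_row' row_id -[RHS]r0; congr (row _ _).
  exact: val_inj.
rewrite r0 r0' r1 r1' addrC -sumrN -big_split /=; apply: eq_bigr => a _.
by rewrite mulrC.
Qed.

(* The rows of [frameE1], [frameZ], [frameE2] are [d/dx_a + p_a d/dz], [d/dz]
   and [d/dp_a]. *)
Definition frameE1 y : 'M[R]_(n, m) := row_mx 1%:M (row_mx (\col_a y 0 (ip a)) 0).
Definition frameE2 : 'M[R]_(n, m) := row_mx 0 (row_mx 0 1%:M).
Definition frameZ : 'rV[R]_m := row_mx 0 (row_mx 1%:M 0).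

Definition frame y : 'M[R]_m := col_mx (frameE1 y) (col_mx frameZ frameE2).

Definition xpart k (v : 'M[R]_(k, m)) : 'M[R]_(k, n) := colsub (@ix n) v.
Definition ppart k (v : 'M[R]_(k, m)) : 'M[R]_(k, n) := colsub (@ip n) v.

Lemma xpart_row_mx k (A : 'M[R]_(k, n)) (B : 'M[R]_(k, 1 + n)) : xpart (row_mx A B) = A.
Proof. by apply/matrixP => i j; rewrite mxE row_mxEl. Qed.

Lemma ppart_row_mx k (A : 'M[R]_(k, n)) b (B : 'M[R]_(k, n)) :
  ppart (row_mx A (row_mx b B)) = B.
Proof. by apply/matrixP => i j; rewrite mxE !row_mxEr. Qed.

Lemma xpart_frameE1 k y (A : 'M[R]_(k, n)) : xpart (A *m frameE1 y) = A.
Proof. by rewrite /frameE1 mul_mx_row xpart_row_mx mulmx1. Qed.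

Lemma ppart_frameE1 k y (A : 'M[R]_(k, n)) : ppart (A *m frameE1 y) = 0.
Proof. by rewrite /frameE1 !mul_mx_row ppart_row_mx mulmx0. Qed.

Lemma xpart_frameE2 k (A : 'M[R]_(k, n)) : xpart (A *m frameE2) = 0.
Proof. by rewrite /frameE2 mul_mx_row xpart_row_mx mulmx0. Qed.

Lemma ppart_frameE2 k (A : 'M[R]_(k, n)) : ppart (A *m frameE2) = A.
Proof. by rewrite /frameE2 !mul_mx_row ppart_row_mx mulmx1. Qed.

(** The coframe dual to [frame y] is [(dx, theta_st, dp)], which supplies the three blocks of
    coefficients. *)
Lemma frame_decomp k y (v : 'M[R]_(k, m)) :
  v = row_mx (xpart v) (row_mx (\col_a theta_st tt y (row a v)) (ppart v)) *m frame y.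
Proof.
rewrite /frame !mul_row_col !mul_mx_row !add_row_mx !mulmx1 !mulmx0 !addr0 !add0r.
rewrite -[LHS]hsubmxK -[X in row_mx _ X]hsubmxK; congr (row_mx _ (row_mx _ _)).
- by apply/matrixP => i j; rewrite !mxE.
- apply/matrixP => i j; rewrite !mxE theta_stE (ord1 j) !mxE.
  rewrite addrC [X in _ = _ + X](_ : _ = \sum_(a < n) y 0 (ip a) * row i v 0 (ix a)).
    by rewrite subrK.
  by apply: eq_bigr => a _; rewrite !mxE mulrC.
- by apply/matrixP => i j; rewrite !mxE.
Qed.

Lemma E1_stP y (v : 'rV[R]_m) : E1_st tt y v <-> v = xpart v *m frameE1 y.
Proof.
split=> [[Dv pv]|->].
  rewrite [LHS](frame_decomp y) /frame !mul_row_col.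
  have -> : \col_a theta_st tt y (row a v) = 0 by apply/colP => a; rewrite (ord1 a) !mxE row_id.
  have -> : ppart v = 0 by apply/rowP => a; rewrite !mxE; exact: pv.
  by rewrite !mul0mx !addr0.
rewrite /frameE1 !mul_mx_row mulmx1 !mulmx0; split=> [|a].
  rewrite /D_st theta_stE /iz /ix row_mxEr row_mxEl mxE.
  apply/eqP; rewrite subr_eq0; apply/eqP; apply: eq_bigr => a _.
  by rewrite row_mxEl !mxE mulrC.
by rewrite /dp /dcoord /ip !row_mxEr mxE.
Qed.

Lemma E2_stP y (v : 'rV[R]_m) : E2_st tt y v <-> v = ppart v *m frameE2.
Proof.
split=> [[Dv xv]|->].
  rewrite [LHS](frame_decomp y) /frame !mul_row_col.
  have -> : \col_a theta_st tt y (row a v) = 0 by apply/colP => a; rewrite (ord1 a) !mxE row_id.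
  have -> : xpart v = 0 by apply/rowP => a; rewrite !mxE; exact: xv.
  by rewrite !mul0mx !add0r.
rewrite /frameE2 !mul_mx_row mulmx1 !mulmx0; split=> [|a].
  rewrite /D_st theta_stE /iz /ix row_mxEr row_mxEl mxE big1 ?subr0 // => a _.
  by rewrite row_mxEl mxE mulr0.
by rewrite /dx /dcoord /ix !row_mxEl mxE.
Qed.

Lemma E1_row_frameE1 y (A : 'rV[R]_n) : E1_st tt y (A *m frameE1 y).
Proof. by apply/E1_stP; rewrite xpart_frameE1. Qed.

Lemma E2_row_frameE2 y (A : 'rV[R]_n) : E2_st tt y (A *m frameE2).
Proof. by apply/E2_stP; rewrite ppart_frameE2. Qed.

Lemma theta_frameZ i y : theta_st i y frameZ = 1.
Proof.
rewrite theta_stE /iz /ix /frameZ row_mxEr row_mxEl mxE eqxx big1 ?subr0 // => a _.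
by rewrite row_mxEl mxE mulr0.
Qed.

Lemma frameE1_smooth (O : set 'rV[R]_m) : open O -> smooth_on O frameE1.
Proof.
move=> oO; apply/smooth_mxP => // i j.
case: (split_ordP j) => [j' ->|j' ->].
  rewrite (_ : (fun _ => _) = fun=> (1%:M : 'M[R]_n) i j'); first exact: smooth_cst.
  by apply/funext => y; rewrite /frameE1 row_mxEl.
case: (split_ordP j') => [j1 ->|j1 ->].
  rewrite (_ : (fun _ => _) = fun y : 'rV[R]_m => y 0 (ip i) : R^o); first exact: smooth_entry.
  by apply/funext => y; rewrite /frameE1 row_mxEr row_mxEl mxE.
rewrite (_ : (fun _ => _) = fun=> (0 : 'M[R]_n) i j1); first exact: smooth_cst.
by apply/funext => y; rewrite /frameE1 !row_mxEr.
Qed.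

(** Non-degeneracy: pairing [u] with [d/dp_a] reads off its [x_a] component, and pairing it with
    [d/dx_a + p_a d/dz] its [p_a] component up to sign. A vector of the distribution without [x] and
    [p] components is zero. *)
Lemma contact_form_st (U : set Rst) : open (U : set 'rV[R]_m) ->
  contact_form U (@D_st R n) (@theta_st R n).
Proof.
move=> oU; split; first exact: theta_st_form.
move=> y [] Uy _; split=> //; first by exists frameZ; rewrite theta_frameZ oner_eq0.
move=> u Du H.
have xu : xpart u = 0.
  apply/rowP => a; have := H (delta_mx 0 a *m frameE2) (E2_row_frameE2 y _).1.
  rewrite extd_theta_st (bigD1 a) //= big1 ?addr0 => [|b ba].
    rewrite /frameE2 !mul_mx_row !mulmx0 mulmx1 /ix /ip row_mxEl !row_mxEr !mxE.
    by rewrite !eqxx mulr0 subr0 mulr1.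
  rewrite /frameE2 !mul_mx_row !mulmx0 mulmx1 /ix /ip row_mxEl !row_mxEr !mxE (negbTE ba) andbF.
  by rewrite !mulr0 subr0.
have pu : ppart u = 0.
  apply/rowP => a; have := H (delta_mx 0 a *m frameE1 y) (E1_row_frameE1 y _).1.
  rewrite extd_theta_st (bigD1 a) //= big1 ?addr0 => [|b ba].
    rewrite /frameE1 !mul_mx_row !mulmx0 mulmx1 /ix /ip row_mxEl !row_mxEr !mxE.
    rewrite !eqxx mulr0 sub0r mulr1.
    by move=> /eqP; rewrite oppr_eq0 => /eqP.
  rewrite /frameE1 !mul_mx_row !mulmx0 mulmx1 /ix /ip row_mxEl !row_mxEr !mxE (negbTE ba) andbF.
  by rewrite !mulr0 subr0.
have : E1_st tt y u.
  by split=> // a; move/rowP/(_ a): pu; rewrite !mxE.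
by move/E1_stP ->; rewrite xu mul0mx.
Qed.

Lemma subbundle_st (U : set Rst) (E : plane_field Rst) (X : 'rV[R]_m -> 'M[R]_(n, m)) :
  open (U : set 'rV[R]_m) -> smooth_on (U : set 'rV[R]_m) X ->
  (forall y, row_free (X y)) -> (forall y v, E tt y v <-> (v <= X y)%MS) ->
  is_subbundle U n E.
Proof.
move=> oU sX fX EX; split.
  move=> y [] [] Uy _ _ v.
  have -> : 'd (@local_rep R m Rst Rst idfun tt tt) (@chart R m Rst tt y) v = v.
    by rewrite (@diff_lin _ _ _ idfun) // => x; exact: cvg_id.
  by [].
move=> y [] Uy _; exists U, X; split=> //.
by have -> : @chart R m Rst tt @` U = U :> set 'rV[R]_m by exact: image_id.
Qed.

Lemma lagrangian_st (U : set Rst) : open (U : set 'rV[R]_m) ->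
  lagrangian_pair n U (@D_st R n) (@E1_st R n) (@E2_st R n).
Proof.
move=> oU; split.
- apply: (@subbundle_st U _ frameE1) => //; first exact: frameE1_smooth.
    move=> y; apply/row_freeP; exists (col_mx 1%:M 0).
    by rewrite mul_row_col mulmx1 mulmx0 addr0.
  move=> y v; split=> [/E1_stP ->|/submxP[A ->]]; first exact: submxMl.
  exact: E1_row_frameE1.
- apply: (@subbundle_st U _ (fun=> frameE2)) => //; first exact: smooth_cst.
    move=> y; apply/row_freeP; exists (col_mx 0 (col_mx 0 1%:M)).
    by rewrite !mul_row_col !mulmx0 mulmx1 !add0r.
  move=> y v; split=> [/E2_stP ->|/submxP[A ->]]; first exact: submxMl.
  exact: E2_row_frameE2.
- move=> y Uy; exists U, (@theta_st R n); split; first by split=> //; exact: contact_form_st.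
  split=> z [] Uz _ u w [_ Eu] [_ Ew]; rewrite extd_theta_st big1 // => a _.
    have -> : u 0 (ip a) = 0 := Eu a; have -> : w 0 (ip a) = 0 := Ew a.
    by rewrite mulr0 mul0r subr0.
  have -> : u 0 (ix a) = 0 := Eu a; have -> : w 0 (ix a) = 0 := Ew a.
  by rewrite mulr0 mul0r subr0.
- move=> y [] Uy _ v; split=> [Dv|[u [w [[Du _] [Dw _] ->]]]].
    exists (xpart v *m frameE1 y), (ppart v *m frameE2).
    split; [exact: E1_row_frameE1|exact: E2_row_frameE2|].
    rewrite [LHS](frame_decomp y) /frame !mul_row_col.
    have -> : \col_a theta_st tt y (row a v) = 0 by apply/colP => a; rewrite (ord1 a) !mxE row_id.
    by rewrite mul0mx add0r.
  have := theta_st_lin tt y 1 1 u w; rewrite !scale1r /D_st => ->.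
  by rewrite Du Dw mulr0 addr0.
- move=> y [] Uy _ v /E1_stP E [_ xv]; rewrite E.
  have -> : xpart v = 0 by apply/rowP => a; rewrite !mxE; exact: xv.
  by rewrite mul0mx.
Qed.

(** [contracts_to_0] speaks of the first argument only; a transposition brings any other argument
    there, at the cost of a sign. *)
Lemma contract_any (E : 'rV[R]_m -> Prop) (phi : 'M[R]_(n, m) -> R) :
  alternating_multilinear phi ->
  (forall v (a : 'I_n), a = 0%N :> nat -> E (row a v) -> phi v = 0) ->
  forall v a, E (row a v) -> phi v = 0.
Proof.
move=> phi_alt H v a Ea.
have n0 : (0 < n)%N by exact: leq_ltn_trans (leq0n a) (ltn_ord a).
pose z := Ordinal n0.
have [az|az] := eqVneq a z; first by apply: (H _ a) => //; rewrite az.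
have := H (row_perm (tperm a z) v) z erefl.
have -> : row z (row_perm (tperm a z) v) = row a v.
  by apply/rowP => j; rewrite !mxE tpermR.
move=> /(_ Ea); rewrite alt_tperm // => /eqP.
by rewrite oppr_eq0 => /eqP.
Qed.

(** * Bi-decomposing forms on vectors of the adapted frame *)

Section Decomposition.
Variables (y : 'rV[R]_m) (phi1 phi2 : 'M[R]_(n, m) -> R).
Hypotheses (phi1_alt : alternating_multilinear phi1)
  (phi2_alt : alternating_multilinear phi2)
  (phi1_E2 : forall v (a : 'I_n), a = 0%N :> nat -> E2_st tt y (row a v) -> phi1 v = 0)
  (phi2_E1 : forall v (a : 'I_n), a = 0%N :> nat -> E1_st tt y (row a v) -> phi2 v = 0).

Let a1 := phi1 (frameE1 y).
Let a2 := phi2 frameE2.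

Lemma row_frame_cases (c : 'I_m) :
  [\/ exists i : 'I_n, row c (frame y) = delta_mx 0 i *m frameE1 y, row c (frame y) = frameZ |
      exists i : 'I_n, row c (frame y) = delta_mx 0 i *m frameE2].
Proof.
rewrite /frame; case: (split_ordP c) => [i ->|c' ->].
  by apply: Or31; exists i; rewrite rowKu rowE.
rewrite rowKd; case: (split_ordP c') => [j ->|i ->].
  by apply: Or32; rewrite rowKu (ord1 j) row_id.
by apply: Or33; exists i; rewrite rowKd rowE.
Qed.

(** If some row lies in [E2_st], both sides vanish, since that row has no [x] part. Otherwise all
    rows lie in [E1_st], where an alternating form of top degree is a multiple of the
    determinant. *)
Lemma phi1_rows (v : 'M[R]_(n, m)) :
  (forall a, (exists i : 'I_n, row a v = delta_mx 0 i *m frameE1 y) \/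
             (exists i : 'I_n, row a v = delta_mx 0 i *m frameE2)) ->
  phi1 v = a1 * \det (xpart v).
Proof.
move=> rv; have [|H] := pselect (exists a, exists i : 'I_n, row a v = delta_mx 0 i *m frameE2).
  move=> [a [i E]]; rewrite (contract_any phi1_alt phi1_E2 (a := a)); last first.
    by rewrite E; exact: E2_row_frameE2.
  rewrite (@det_row0 _ _ _ a) ?mulr0 // => j.
  have -> : xpart v a j = xpart (row a v) 0 j by rewrite !mxE.
  by rewrite E xpart_frameE2 mxE.
have -> : v = xpart v *m frameE1 y.
  apply/row_matrixP => a; rewrite row_mul.
  have [[i E]|[i E]] := rv a; last by case: H; exists a, i.
  have -> : row a (xpart v) = xpart (row a v) by apply/rowP => j; rewrite !mxE.
  by rewrite E xpart_frameE1.
by rewrite xpart_frameE1 alt_mulmx // mulrC.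
Qed.

(** The same dichotomy as for [phi1], with the two subbundles exchanged. *)
Lemma phi2_rows (v : 'M[R]_(n, m)) :
  (forall a, (exists i : 'I_n, row a v = delta_mx 0 i *m frameE1 y) \/
             (exists i : 'I_n, row a v = delta_mx 0 i *m frameE2)) ->
  phi2 v = a2 * \det (ppart v).
Proof.
move=> rv; have [|H] := pselect (exists a, exists i : 'I_n, row a v = delta_mx 0 i *m frameE1 y).
  move=> [a [i E]]; rewrite (contract_any phi2_alt phi2_E1 (a := a)); last first.
    by rewrite E; exact: E1_row_frameE1.
  rewrite (@det_row0 _ _ _ a) ?mulr0 // => j.
  have -> : ppart v a j = ppart (row a v) 0 j by rewrite !mxE.
  by rewrite E ppart_frameE1 mxE.
have -> : v = ppart v *m frameE2.
  apply/row_matrixP => a; rewrite row_mul.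
  have [[i E]|[i E]] := rv a; first by case: H; exists a, i.
  have -> : row a (ppart v) = ppart (row a v) by apply/rowP => j; rewrite !mxE.
  by rewrite E ppart_frameE2.
by rewrite ppart_frameE2 alt_mulmx // mulrC.
Qed.

Lemma phi1_E1_neq0 v : (forall a, E1_st tt y (row a v)) -> phi1 v != 0 -> a1 != 0.
Proof.
move=> Ev; have -> : v = xpart v *m frameE1 y.
  apply/row_matrixP => a; rewrite row_mul {1}((E1_stP y _).1 (Ev a)); congr (_ *m _).
  by apply/rowP => j; rewrite !mxE.
by rewrite alt_mulmx // mulf_eq0 negb_or => /andP[].
Qed.

Lemma phi2_E2_neq0 v : (forall a, E2_st tt y (row a v)) -> phi2 v != 0 -> a2 != 0.
Proof.
move=> Ev; have -> : v = ppart v *m frameE2.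
  apply/row_matrixP => a; rewrite row_mul {1}((E2_stP y _).1 (Ev a)); congr (_ *m _).
  by apply/rowP => j; rewrite !mxE.
by rewrite alt_mulmx // mulf_eq0 negb_or => /andP[].
Qed.

End Decomposition.

End Standard.

(* Both sides are multilinear, so it suffices to compare them on the vectors
   of the frame [(frameE1, d/dz, frameE2)] adapted to the Lagrangian pair. *)
Lemma hesse_decomp (R : realType) k (y : 'rV[R]_(dim2n1 k.+1))
    (phi1 phi2 : 'M[R]_(k.+1, dim2n1 k.+1) -> R) (v : 'M[R]_(k.+1, dim2n1 k.+1)) :
  alternating_multilinear phi1 -> alternating_multilinear phi2 ->
  (forall v (a : 'I_k.+1), a = 0%N :> nat -> E2_st tt y (row a v) -> phi1 v = 0) ->
  (forall v (a : 'I_k.+1), a = 0%N :> nat -> E1_st tt y (row a v) -> phi2 v = 0) ->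
  let phi v := phi1 v - phi2 v in
  phi v = phi1 (frameE1 y) * \det (xpart v) - phi2 (frameE2 R k.+1) * \det (ppart v) +
    \sum_(a < k.+1) (-1) ^+ a * (theta_st tt y (row a v) *
      phi (col_mx (frameZ R k.+1) (row' a v) : 'M[R]_(1 + k, dim2n1 k.+1))).
Proof.
move=> alt1 alt2 c1 c2 phi.
have phi_alt : alternating_multilinear phi.
  have phiE w : phi w = 1 * phi1 w + -1 * phi2 w by rewrite mul1r mulN1r.
  apply: alternatingP.
    have := ml_comb 1 (-1) (alt_ml alt1) (alt_ml alt2).
    by congr (multilinear _); apply/funext => w; rewrite phiE.
  by move=> A a b ab E; rewrite phiE (alt1.2 A a b) // (alt2.2 A a b) // !mulr0 addr0.
pose T := frameZ R k.+1.
pose gamma (A : 'M[R]_(k, dim2n1 k.+1)) := phi (col_mx T A : 'M[R]_(1 + k, dim2n1 k.+1)).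
have gamma_ml : multilinear gamma by exact/ml_col_mx/alt_ml.
pose psi v := 1 * (phi1 (frameE1 y) * \det (xpart v) + - phi2 (frameE2 R k.+1) * \det (ppart v)) +
    1 * \sum_(a < k.+1) (-1) ^+ a * (theta_st tt y (row a v) * gamma (row' a v)).
suff : phi v = psi v by rewrite /psi !mul1r mulNr.
rewrite (frame_decomp y v).
apply: eq_ml_mulmx; first exact: alt_ml.
  apply: ml_comb; last by apply: ml_wedge1 => // *; exact: theta_st_lin.
  by apply: ml_comb; apply: alt_ml; exact: alt_det.
move=> f; set V := rowsub f (frame y).
have rV a : row a V = row (f a) (frame y) by rewrite row_rowsub.
rewrite /psi !mul1r mulNr.
(* If row [a] is [d/dz], both determinants vanish, and so do the summands other than [a], in which
   [phi] meets [d/dz] twice. The summand [a] is [phi V] after row [a] is moved back from the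
   front. *)
have [[a aT]|noT] := pselect (exists a, row a V = T).
  have gamma0 c : c != a -> gamma (row' c V) = 0.
    move=> ca; have /unlift_some[a1 a1E _] := ca.
    apply: (phi_alt.2 _ (ord0 : 'I_k.+1) (lift ord0 a1)) => //.
    by rewrite row_col_mx0 row_col_mxS row_row' -a1E aT.
  rewrite (bigD1 a) //= [X in _ + (_ + X)]big1 ?addr0; last first.
    by move=> c ca; rewrite gamma0 // !mulr0.
  have xV : \det (xpart V) = 0.
    apply: (@det_row0 _ _ _ a) => j; have -> : xpart V a j = row a V 0 (ix j) by rewrite !mxE.
    by rewrite aT /T /frameZ /ix row_mxEl mxE.
  have pV : \det (ppart V) = 0.
    apply: (@det_row0 _ _ _ a) => j; have -> : ppart V a j = row a V 0 (ip j) by rewrite !mxE.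
    by rewrite aT /T /frameZ /ip !row_mxEr mxE.
  rewrite xV pV !mulr0 subr0 add0r aT theta_frameZ mul1r /gamma -aT alt_row_first //.
  by rewrite signrMK.
have rv a : (exists i : 'I_k.+1, row a V = delta_mx 0 i *m frameE1 y) \/
             (exists i : 'I_k.+1, row a V = delta_mx 0 i *m frameE2 R k.+1).
  have [E|E|E] := row_frame_cases y (f a); rewrite rV; [by left| |by right].
  by case: noT; exists a; rewrite rV.
rewrite big1 ?addr0 => [|a _].
  by rewrite /phi (phi1_rows alt1 c1 rv) (phi2_rows alt2 c2 rv).
suff -> : theta_st tt y (row a V) = 0 by rewrite mul0r mulr0.
by have [[i ->]|[i ->]] := rv a; [exact: (E1_row_frameE1 y _).1|exact: (E2_row_frameE2 y _).1].
Qed.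

Lemma form_near_is_form (R : realType) m (U : set (euclid R m)) k (alpha : mform (euclid R m) k) :
  (forall q, U q -> form_near q alpha) -> is_form U alpha.
Proof.
move=> H; apply/euclid_is_form; split=> [y Uy|v s y Uy].
  by have [W [_ Wy Fa _]] := form_nearP (H y Uy); exact: Fa.
by have [W [_ Wy _ Fs]] := form_nearP (H y Uy); exact: Fs.
Qed.

Lemma diffeo_restrict (R : realType) m (M M' : manifold R m) (N W : set M) (U : set M')
    (Phi : M -> M') (Psi : M' -> M) :
  diffeo N U Phi Psi -> open W ->
  diffeo (N `&` W) (U `&` Psi @^-1` W) Phi Psi.
Proof.
move=> [[oN oU] [cPhi sPhi] [cPsi sPsi] HN HU] oW; split.
- split; first exact: openI.
  exact: open_setI_preimage.
- split=> [p [Np _]|i j]; first exact: cPhi.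
  by apply: sub_smooth (sPhi i j) => _ [p [[[Np Wp] dp] dj] <-]; exists p.
- split=> [p [Up _]|i j]; first exact: cPsi.
  by apply: sub_smooth (sPsi i j) => _ [p [[[Np Wp] dp] dj] <-]; exists p.
- by move=> p [Np Wp]; have [Up E] := HN p Np; split=> //; split=> //=; rewrite E.
- by move=> q [Uq Wq]; have [Nq E] := HU q Uq.
Qed.

(** * The function F and the remainder along the contact form *)

Section Hesse.
Variables (R : realType) (n : nat).
Notation m := (dim2n1 n).
Notation Rst := (euclid R m).
Variables (U : set 'rV[R]_m) (Omega1 Omega2 : mform Rst n).
Hypotheses (oU : open U) (F1 : is_form (U : set Rst) Omega1) (F2 : is_form (U : set Rst) Omega2).
Hypotheses
  (omega1_vol : forall y, U y -> exists v, (forall a, E1_st tt y (row a v)) /\ Omega1 tt y v != 0)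
  (omega2_vol : forall y, U y -> exists v, (forall a, E2_st tt y (row a v)) /\ Omega2 tt y v != 0).

(** The [x] part of [frameE1 y] is the identity. For [Omega1] killing [E2_st], this value is thus
    the coefficient of [dx_1 /\ .. /\ dx_n] on the contact distribution; [coef2] plays the same part
    for [dp_1 /\ .. /\ dp_n]. *)
Definition coef1 (y : 'rV[R]_m) : R := Omega1 tt y (frameE1 y).
Definition coef2 (y : 'rV[R]_m) : R := Omega2 tt y (frameE2 R n).
Definition hesse_coef (y : 'rV[R]_m) : R := coef1 y / coef2 y.

Let alt1 y : U y -> alternating_multilinear (Omega1 tt y).
Proof. by move/euclid_is_form : F1 => [H _]; exact: H. Qed.
Let alt2 y : U y -> alternating_multilinear (Omega2 tt y).
Proof. by move/euclid_is_form : F2 => [H _]; exact: H. Qed.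

Lemma coef1_neq0 y : U y -> coef1 y != 0.
Proof.
by move=> Uy; have [v [Ev v0]] := omega1_vol Uy; exact: phi1_E1_neq0 (alt1 Uy) _ Ev v0.
Qed.

Lemma coef2_neq0 y : U y -> coef2 y != 0.
Proof.
by move=> Uy; have [v [Ev v0]] := omega2_vol Uy; exact: phi2_E2_neq0 (alt2 Uy) _ Ev v0.
Qed.

Lemma hesse_coef_neq0 y : U y -> hesse_coef y != 0.
Proof.
by move=> Uy; rewrite mulf_neq0 ?invr_neq0 ?coef1_neq0 ?coef2_neq0.
Qed.

Lemma coef2_smooth : smooth_on U (coef2 : 'rV[R]_m -> R^o).
Proof. by move/euclid_is_form : F2 => [_ H]; exact: H. Qed.

(** [frameE1] moves with the point, so smoothness of [Omega1] on constant vectors is extended by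
    [smooth_family]. *)
Lemma coef1_smooth : smooth_on U (coef1 : 'rV[R]_m -> R^o).
Proof.
move/euclid_is_form : F1 => [Fa Fs].
apply: (@smooth_family _ _ _ _ U U (Omega1 tt) (fun y => y) (fun y => frameE1 y) oU oU) => //.
- by move=> y Uy; exact/alt_ml/Fa.
- exact: smooth_id.
- exact: frameE1_smooth.
Qed.

Lemma hesse_coef_smooth : smooth_on U (hesse_coef : 'rV[R]_m -> R^o).
Proof.
apply: smoothM oU coef1_smooth _; apply: smoothV oU _ coef2_smooth.
exact: coef2_neq0.
Qed.

End Hesse.

(* For [n > 0] the remainder is [theta_st /\ eta], where [eta] is the contraction
   of [Omega1 - Omega2] with [d/dz]; for [n = 0] there is none. *)
Lemma hesse_remainder (R : realType) n (U : set 'rV[R]_(dim2n1 n))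
    (Omega1 Omega2 : mform (euclid R (dim2n1 n)) n) (q : euclid R (dim2n1 n))
    (J : forall k, mform (euclid R (dim2n1 n)) k -> Prop) :
  open U -> is_form (U : set (euclid R (dim2n1 n))) Omega1 ->
  is_form (U : set (euclid R (dim2n1 n))) Omega2 ->
  (forall y, U y -> forall v (a : 'I_n), a = 0%N :> nat -> E2_st tt y (row a v) ->
     Omega1 tt y v = 0) ->
  (forall y, U y -> forall v (a : 'I_n), a = 0%N :> nat -> E1_st tt y (row a v) ->
     Omega2 tt y v = 0) ->
  (forall y, U y -> coef2 Omega2 y != 0) ->
  is_ideal q J -> U q -> J 1%N (@theta_st R n) ->
  exists2 rest : mform (euclid R (dim2n1 n)) n, J n rest &
    forall y, U y -> forall v, subf Omega1 Omega2 tt y v =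
      coef2 Omega2 y * hesse_form (hesse_coef Omega1 Omega2) tt y v + rest tt y v.
Proof.
move=> oU F1 F2 c1 c2 b0 JI Uq Jt.
have hE y v : U y -> coef2 Omega2 y * hesse_form (hesse_coef Omega1 Omega2) tt y v =
    coef1 Omega1 y * \det (xpart v) - coef2 Omega2 y * \det (ppart v).
  by move=> Uy; rewrite hesse_formE mulrBr mulrA mulrCA mulfV ?b0 // mulr1.
case: n U Omega1 Omega2 q J oU F1 F2 c1 c2 b0 JI Uq Jt hE =>
  [|k] U Omega1 Omega2 q J oU F1 F2 c1 c2 b0 JI Uq Jt hE.
  exists (@mform0 R _ _ 0); first exact: (ideal_0 JI).
  move=> y Uy v; rewrite addr0 hE // !det_mx00 !mulr1 /subf /coef1 /coef2.
  by congr (_ - _); congr (_ tt y _); apply/matrixP => -[].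
have F : is_form (U : set (euclid R (dim2n1 k.+1))) (subf Omega1 Omega2).
  move/euclid_is_form: F1 => [Fa1 Fs1]; move/euclid_is_form: F2 => [Fa2 Fs2].
  apply/euclid_is_form; split=> [y Uy|v].
    have phiE w : subf Omega1 Omega2 tt y w = 1 * Omega1 tt y w + -1 * Omega2 tt y w.
      by rewrite mul1r mulN1r.
    apply: alternatingP.
      have := ml_comb 1 (-1) (alt_ml (Fa1 y Uy)) (alt_ml (Fa2 y Uy)).
      by congr (multilinear _); apply/funext => w; rewrite phiE.
    by move=> A a b ab E; rewrite phiE ((Fa1 y Uy).2 A a b) // ((Fa2 y Uy).2 A a b) // !mulr0 addr0.
  by apply: smoothD => //; exact: smoothN.
pose eta : mform (euclid R (dim2n1 k.+1)) k :=
  fun i y A => subf Omega1 Omega2 i y (col_mx (frameZ R k.+1) A : 'M[R]_(1 + k, dim2n1 k.+1)).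
have Feta : is_form (U : set (euclid R (dim2n1 k.+1))) eta.
  move/euclid_is_form: F => [Fa Fs]; apply/euclid_is_form; split=> [y Uy|v].
    by apply: (@alt_col_mx _ _ k (subf Omega1 Omega2 tt y)); exact: Fa.
  exact: Fs.
exists (wedge (@theta_st R k.+1) eta).
  have Fe : form_near q eta by exists U.
  exact: (ideal_wedger JI Fe Jt).
move=> y Uy v; move/euclid_is_form: Feta => [Fa _].
rewrite (wedge1E _ _ (Fa y Uy)) hE //.
move/euclid_is_form: F1 => [Fa1 _]; move/euclid_is_form: F2 => [Fa2 _].
exact: (hesse_decomp v (Fa1 y Uy) (Fa2 y Uy) (c1 y Uy) (c2 y Uy)).
Qed.

Lemma bidecomposing_st (R : realType) n (U : set 'rV[R]_(dim2n1 n)) (F : 'rV[R]_(dim2n1 n) -> R) :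
  open U -> smooth_on U (F : 'rV[R]_(dim2n1 n) -> R^o) -> (forall y, U y -> F y != 0) ->
  bidecomposing (U : set (euclid R (dim2n1 n))) (@E1_st R n) (@E2_st R n)
    (scalef F (wedges (@dx R n))) (wedges (@dp R n)).
Proof.
move=> oU sF F0.
have dxE y v : wedges (@dx R n) tt y v = \det (xpart v) by exact: wedges_dcoord.
have dpE y v : wedges (@dp R n) tt y v = \det (ppart v) by exact: wedges_dcoord.
have fdx y : wedges (@dx R n) tt y = fun v => \det (xpart v) by apply/funext => v.
have fdp y : wedges (@dp R n) tt y = fun v => \det (ppart v) by apply/funext => v.
split.
- split; apply/euclid_is_form; split=> [y Uy|v].
  + have D := @alt_det R n _ (@ix n).
    rewrite /scalef fdx; apply: alternatingP.
      have := ml_comb (F y) 0 (alt_ml D) (alt_ml D).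
      by under eq_fun do rewrite mul0r addr0.
    by move=> A a b ab E; rewrite (D.2 A a b) // mulr0.
  + under eq_fun do rewrite /scalef dxE.
    by apply: smoothM => //; exact: smooth_cst.
  + by rewrite fdp; exact: alt_det.
  + by under eq_fun do rewrite dpE; exact: smooth_cst.
- move=> y [] Uy _ v a _ [_ xa]; rewrite /scalef dxE (@det_row0 _ _ _ a) ?mulr0 // => j.
  by have := xa j; rewrite /dx /dcoord !mxE.
- move=> y [] Uy _ v a _ [_ pa]; rewrite dpE (@det_row0 _ _ _ a) // => j.
  by have := pa j; rewrite /dp /dcoord !mxE.
- move=> y [] Uy _; exists (frameE1 y); split=> [a|].
    by rewrite -[frameE1 y]mul1mx row_mul; exact: E1_row_frameE1.
  by rewrite /scalef dxE -[frameE1 y]mul1mx xpart_frameE1 det1 mulr1 F0.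
- move=> y [] Uy _; exists (frameE2 R n); split=> [a|].
    by rewrite -[frameE2 R n]mul1mx row_mul; exact: E2_row_frameE2.
  by rewrite dpE -[frameE2 R n]mul1mx ppart_frameE2 det1 oner_neq0.
Qed.

(** * Representation by a Hesse form *)

Section Representation.
Variables (R : realType) (n : nat) (M : manifold R (dim2n1 n)).
Notation m := (dim2n1 n).
Notation Rst := (euclid R m).
Variables (N : set M) (U : set 'rV[R]_m) (Phi : M -> 'rV[R]_m) (Psi : 'rV[R]_m -> M).
Variable (i0 : idx M).
Hypothesis Ndom : N `<=` dom i0.
Hypothesis dPhi : @diffeo R m M Rst N U Phi Psi.
Variables (D E1 E2 : plane_field M) (I : form_sheaf M).
Hypotheses (pD : @pushes_to R m M Rst N Phi D (@D_st R n))
  (pE1 : @pushes_to R m M Rst N Phi E1 (@E1_st R n))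
  (pE2 : @pushes_to R m M Rst N Phi E2 (@E2_st R n)).
Hypothesis I_EDS : is_EDS N I.
Variables (theta : mform M 1) (omega1 omega2 : mform M n).
Hypotheses (omega_bi : bidecomposing N E1 E2 omega1 omega2)
  (theta_contact : contact_form N D theta)
  (I_gen : forall p, N p -> forall k (alpha : mform M k),
     I p alpha <-> generated theta (subf omega1 omega2) p alpha).

Let oN : open N. Proof. by case: dPhi => -[]. Qed.
Let oU : open U. Proof. by case: dPhi => -[]. Qed.
Let PhiK p : N p -> Psi (Phi p) = p.
Proof. by case: dPhi => _ _ _ H _ /H[]. Qed.
Let PhiU p : N p -> U (Phi p).
Proof. by case: dPhi => _ _ _ H _ /H[]. Qed.
Let PsiK q : U q -> Phi (Psi q) = q.
Proof. by case: dPhi => _ _ _ _ H /H[]. Qed.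
Let PsiN q : U q -> N (Psi q).
Proof. by case: dPhi => _ _ _ _ H /H[]. Qed.
Let Psi_cont q : U q -> {for q, continuous Psi}.
Proof. by case: dPhi => _ _ [H _] _ _; exact: H. Qed.

Let pull k (alpha : mform Rst k) : mform M k := Pull Phi alpha.
Let push k (beta : mform M k) : mform Rst k := Push Psi i0 beta.

Let psi : 'rV[R]_m -> 'rV[R]_m := chart i0 \o Psi.
Let phi : 'rV[R]_m -> 'rV[R]_m := Phi \o param i0.

Let JJ q : U q -> 'J psi q *m 'J phi (psi q) = 1%:M.
Proof. exact: jacobian_push_pull Ndom dPhi q. Qed.

(** [pushes_to] is phrased with the differential of [Phi]; the Jacobian of [psi] inverts it, so it
    is applied to the vector [v *m 'J psi q]. *)
Let push_plane (E : plane_field M) (E' : plane_field Rst) q (v : 'rV[R]_m) :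
  @pushes_to R m M Rst N Phi E E' -> U q ->
  E i0 (psi q) (v *m 'J psi q) <-> E' tt q v.
Proof.
move=> pE Uq; have Nq := PsiN Uq.
have := pE (Psi q) i0 tt Nq (Ndom Nq) Logic.I (v *m 'J psi q).
have -> : @chart R m Rst tt (Phi (Psi q)) = q by exact: PsiK.
have -> : 'd (@local_rep R m M Rst Phi i0 tt) (chart i0 (Psi q)) (v *m 'J psi q) = v.
  transitivity ((v *m 'J psi q) *m 'J phi (psi q)).
    exact: (esym (mul_rV_lin1 _ _)).
  by rewrite -mulmxA JJ // mulmx1.
by [].
Qed.

Let pull_plane (E : plane_field M) (E' : plane_field Rst) q (w : 'rV[R]_m) :
  @pushes_to R m M Rst N Phi E E' -> U q ->
  E i0 (psi q) w -> E' tt q (w *m 'J phi (psi q)).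
Proof.
move=> pE Uq Ew; apply/(push_plane _ pE Uq).
by rewrite -mulmxA (mulmx1C (JJ Uq)) mulmx1.
Qed.

Let Omega1 := push omega1.
Let Omega2 := push omega2.
Let F := hesse_coef Omega1 Omega2.

Let push_form k (beta : mform M k) : is_form N beta -> is_form (U : set Rst) (push beta).
Proof.
move=> Fb; apply: form_near_is_form => q Uq.
by apply: (form_near_Push Ndom dPhi Uq); exists N; split=> //; exact: PsiN.
Qed.

Let F1 : is_form (U : set Rst) Omega1.
Proof. by apply: push_form; case: omega_bi => -[]. Qed.
Let F2 : is_form (U : set Rst) Omega2.
Proof. by apply: push_form; case: omega_bi => -[]. Qed.

Let omega1_E2 y : U y -> forall v (a : 'I_n), a = 0%N :> nat -> E2_st tt y (row a v) ->
     Omega1 tt y v = 0.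
Proof.
move=> Uy v a a0 Ea; case: omega_bi => _ H _ _ _; have Ny := PsiN Uy.
apply: (H _ _ Ny (Ndom Ny) _ a a0).
by rewrite row_mul; apply/(push_plane _ pE2 Uy).
Qed.

Let omega2_E1 y : U y -> forall v (a : 'I_n), a = 0%N :> nat -> E1_st tt y (row a v) ->
     Omega2 tt y v = 0.
Proof.
move=> Uy v a a0 Ea; case: omega_bi => _ _ H _ _; have Ny := PsiN Uy.
apply: (H _ _ Ny (Ndom Ny) _ a a0).
by rewrite row_mul; apply/(push_plane _ pE1 Uy).
Qed.

Let push_volume (E : plane_field M) (E' : plane_field Rst) (omega : mform M n) y :
  @pushes_to R m M Rst N Phi E E' -> volume_on N E omega -> U y ->
  exists v, (forall a, E' tt y (row a v)) /\ push omega tt y v != 0.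
Proof.
move=> pE H Uy; have Ny := PsiN Uy.
have [v [Ev v0]] := H _ _ Ny (Ndom Ny).
exists (v *m 'J phi (psi y)); split=> [a|].
  by rewrite row_mul; exact: (pull_plane pE Uy (Ev a)).
by rewrite /push /Push -mulmxA (mulmx1C (JJ Uy)) mulmx1.
Qed.

Let omega1_vol y : U y -> exists v, (forall a, E1_st tt y (row a v)) /\ Omega1 tt y v != 0.
Proof. by apply: push_volume pE1 _; case: omega_bi. Qed.

Let omega2_vol y : U y -> exists v, (forall a, E2_st tt y (row a v)) /\ Omega2 tt y v != 0.
Proof. by apply: push_volume pE2 _; case: omega_bi. Qed.

Lemma hesse_coef_push_smooth : smooth_on U (F : 'rV[R]_m -> R^o).
Proof. exact: (hesse_coef_smooth oU F1 F2 omega2_vol). Qed.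

Lemma hesse_coef_push_neq0 y : U y -> F y != 0.
Proof. exact: (hesse_coef_neq0 F1 F2 omega1_vol omega2_vol). Qed.

(** The ratio of the two contact forms, read on [d/dz], where [theta_st] takes the value 1. *)
Let g (y : 'rV[R]_m) : R := push theta tt y (frameZ R n).

Let theta_form : is_form N theta := theta_contact.1.

Let Ftheta : is_form (U : set Rst) (push theta).
Proof. exact: push_form. Qed.

Let g_smooth : smooth_on U (g : 'rV[R]_m -> R^o).
Proof. by move/euclid_is_form : Ftheta => [_ H]; exact: H. Qed.

(** Both forms vanish on the contact hyperplane, and [v] differs from the vector [w] of that
    hyperplane by [theta_st v] times [d/dz]. *)
Let push_thetaE y : U y -> forall v, push theta tt y v = g y * theta_st tt y v.
Proof.
move=> Uy v; move/euclid_is_form : Ftheta => [/(_ y Uy)/alt_ml ml _].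
have Ny := PsiN Uy.
pose w := v - theta_st tt y v *: frameZ R n.
have Dw : D_st tt y w.
  have := theta_st_lin tt y 1 (- theta_st tt y v) v (frameZ R n).
  by rewrite scale1r scaleNr /D_st => ->; rewrite theta_frameZ mulr1 mul1r subrr.
have w0 : push theta tt y w = 0.
  have [H _ _] := theta_contact.2 _ _ Ny (Ndom Ny).
  by apply/H; apply/(push_plane _ pD Uy).
have := ml v w (frameZ R n) ord0 1 (theta_st tt y v).
rewrite w0 mulr0 add0r mulrC => ->//.
- by rewrite !row_id scale1r /w subrK.
- by move=> i; rewrite (ord1 i) eqxx.
- by move=> i; rewrite (ord1 i) eqxx.
Qed.

Let g_neq0 y : U y -> g y != 0.
Proof.
move=> Uy; apply/eqP => g0; have Ny := PsiN Uy.
have [_ [w w0] _] := theta_contact.2 _ _ Ny (Ndom Ny).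
have := push_thetaE Uy (w *m 'J phi (psi y)).
rewrite g0 mul0r /push /Push -mulmxA (mulmx1C (JJ Uy)) mulmx1 => w00.
by move: w0; rewrite [theta _ _ _]w00 eqxx.
Qed.

(* Transporting [I], rather than taking the ideal generated by [theta_st] and
   [hesse_form F], makes closedness under [d] a consequence of that of [I]. *)
Definition I_st : form_sheaf Rst := fun q k alpha => I (Psi q) (pull alpha).

Let I_ideal p : N p -> is_ideal p (I p).
Proof. exact: (eds_ideal I_EDS). Qed.

Let I_st_ideal q : U q -> is_ideal (q : Rst) (I_st q).
Proof.
move=> Uq; have Nq := PsiN Uq.
by have := ideal_Pull Ndom dPhi Nq (I_ideal Nq); rewrite (PsiK Uq).
Qed.

Let I_st_push q k (beta : mform M k) : U q -> I (Psi q) beta -> I_st q (push beta).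
Proof.
move=> Uq Ib; have Nq := PsiN Uq.
have PP := Pull_Push Ndom dPhi Nq (ideal_form (I_ideal Nq) Ib).
exact: (ideal_germ (I_ideal Nq)) (form_eq_near_sym PP) Ib.
Qed.

Let I_theta p : N p -> I p theta.
Proof. by move=> Np; apply/(I_gen Np) => J JI Jt _ _. Qed.

Let I_omega p : N p -> I p (subf omega1 omega2).
Proof. by move=> Np; apply/(I_gen Np) => J JI _ _ Jo. Qed.

Lemma I_st_theta q : U q -> I_st q (@theta_st R n).
Proof.
move=> Uq; have JI := I_st_ideal Uq.
have J1 := I_st_push Uq (I_theta (PsiN Uq)).
apply: (ideal_germ JI) _ (ideal_scale JI oU Uq (smoothV oU g_neq0 g_smooth) J1).
apply: (form_eq_nearP oU Uq) => y Uy v.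
by rewrite /scalef push_thetaE // mulKf // g_neq0.
Qed.

Let remainder q (J : forall k, mform Rst k -> Prop) :
  is_ideal (q : Rst) J -> U q -> J 1%N (@theta_st R n) ->
  exists2 rest : mform Rst n, J n rest &
    forall y, U y -> forall v, subf Omega1 Omega2 tt y v =
      coef2 Omega2 y * hesse_form F tt y v + rest tt y v.
Proof.
exact: (hesse_remainder oU F1 F2 omega1_E2 omega2_E1 (coef2_neq0 F2 omega2_vol)).
Qed.

(** The remainder lies in [I_st] because [theta_st] does. It is subtracted from the transported
    generator, and the difference is divided by [coef2]. *)
Lemma I_st_hesse q : U q -> I_st q (hesse_form F).
Proof.
move=> Uq; have JI := I_st_ideal Uq.
have [rest Jr E] := remainder JI Uq (I_st_theta Uq).
have J1 := I_st_push Uq (I_omega (PsiN Uq)).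
have J2 := ideal_sub JI J1 Jr.
have s2 := smoothV oU (coef2_neq0 F2 omega2_vol) (coef2_smooth F2).
apply: (ideal_germ JI) _ (ideal_scale JI oU Uq s2 J2).
apply: (form_eq_nearP oU Uq) => y Uy v.
have EE : push (subf omega1 omega2) tt y v = _ := E y Uy v.
by rewrite /scalef /subf EE addrK mulKf // (coef2_neq0 F2 omega2_vol).
Qed.

Lemma I_st_extd q k (alpha : mform Rst k) : U q -> I_st q alpha -> I_st q (extd alpha).
Proof.
move=> Uq Ia; have Nq := PsiN Uq.
have Fa : form_near (Phi (Psi q) : Rst) alpha.
  by rewrite (PsiK Uq); exact: (ideal_form (I_st_ideal Uq) Ia).
apply: (ideal_germ (I_ideal Nq)) (Pull_extd dPhi Nq Fa) _.
exact: (eds_extd I_EDS Nq Ia).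
Qed.

Lemma I_st_EDS : is_EDS (U : set Rst) I_st.
Proof.
split=> [q Uq|q k alpha Uq|q k alpha Uq Ia]; first exact: I_st_ideal.
  exact: I_st_extd.
have [W [oW Wq IW]] := eds_open I_EDS (PsiN Uq) Ia.
exists (U `&` Psi @^-1` W); split=> //.
  exact: (@open_setI_preimage Rst).
by move=> q' [_ Wq']; exact: IW.
Qed.

(** From left to right, an arbitrary ideal [J] at [q] is carried by [ideal_Push] to an ideal at
    [Psi q]. The given generators of [I] are shown to lie in it, so [pull alpha] does as well, and
    pushing forward returns [alpha] to [J]. *)
Lemma I_st_generated q : U q -> forall k (alpha : mform Rst k),
  I_st q alpha <-> generated (@theta_st R n) (hesse_form F) q alpha.
Proof.
move=> Uq k alpha; have Nq := PsiN Uq; split=> [Ia J JI Jt Jdt Jh|]; last first.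
  by apply; [exact: I_st_ideal|exact: I_st_theta|exact/I_st_extd/I_st_theta|exact: I_st_hesse].
have JI' : is_ideal (Phi (Psi q) : Rst) J by rewrite (PsiK Uq).
have KI := ideal_Push Ndom dPhi Nq JI'.
have PP l (beta : mform M l) : I (Psi q) beta ->
    form_eq_near (Psi q) (Pull Phi (Push Psi i0 beta)) beta.
  by move=> /(ideal_form (I_ideal Nq)) Fb; exact: (Pull_Push Ndom dPhi Nq Fb).
have It := I_theta Nq.
have Idt := eds_extd I_EDS Nq It.
have gE : form_eq_near (q : Rst) (scalef g (@theta_st R n)) (push theta).
  by apply: (form_eq_nearP oU Uq) => y Uy v; rewrite push_thetaE.
have [Jpa _] : J k (push (pull alpha)) /\
    form_eq_near (Psi q) (pull (push (pull alpha))) (pull alpha).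
  apply: ((I_gen Nq _).1 Ia _ KI).
  - split; last exact: PP.
    by apply: (ideal_germ JI) gE _; exact: (ideal_scale JI oU Uq g_smooth Jt).
  (* Near [q], the push forward of [extd theta] is the exterior derivative of [g theta_st], which
     the Leibniz rule places in [J]. *)
  - split; last exact: PP.
    have Ft := ideal_form (I_ideal Nq) It.
    apply: (ideal_germ JI) (Push_extd Ndom dPhi Uq Ft) _.
    apply: (ideal_germ JI) (form_eq_near_extd gE) _.
    exact: (ideal_extd_scale JI oU Uq g_smooth Jt Jdt).
  - split; last exact: PP (I_omega Nq).
    have [rest Jr E] := remainder JI Uq Jt.
    apply: (ideal_germ JI) _ (ideal_add JI (ideal_scale JI oU Uq (coef2_smooth F2) Jh) Jr).
    by apply: (form_eq_nearP oU Uq) => y Uy v; apply/esym; exact: E.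
exact: (ideal_germ JI) (Push_Pull Ndom dPhi alpha Uq) Jpa.
Qed.

Lemma st_local_generator : local_generator (U : set Rst) (@D_st R n) I_st (hesse_form F).
Proof.
split; first exact: hesse_form_form oU hesse_coef_push_smooth.
exists (@theta_st R n); split; first exact: contact_form_st.
exact: I_st_generated.
Qed.

Lemma st_MA_system : MA_system_with_pair n (U : set Rst) (@D_st R n) (@E1_st R n) (@E2_st R n) I_st.
Proof.
split; last first.
(* The difference of these two forms unfolds to [hesse_form F]. *)
- move=> q Uq; exists U, (scalef F (wedges (@dx R n))), (wedges (@dp R n)).
  split=> //; first exact: bidecomposing_st oU hesse_coef_push_smooth hesse_coef_push_neq0.
  exact: st_local_generator.
- exact: lagrangian_st.
split; [|exact: I_st_EDS|].
- split=> // q Uq; exists U, (@theta_st R n); split=> //; exact: contact_form_st.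
- by move=> q Uq; exists U, (hesse_form F); split=> //; exact: st_local_generator.
Qed.

Lemma pulls_back_st : @pulls_back_to R m M Rst N Phi I_st I.
Proof.
move=> p Np k beta; have IE : @I_st (Phi p) = fun k alpha => I p (pull alpha).
  by rewrite /I_st (PhiK Np).
rewrite IE; split=> [Ib|[alpha Ia [W [oW Wp E]]]].
  have PP := Pull_Push Ndom dPhi Np (ideal_form (I_ideal Np) Ib).
  exists (push beta).
    by apply: (ideal_germ (I_ideal Np)) _ Ib; exact: form_eq_near_sym.
  have [W [oW Wp EW]] := PP; exists (N `&` W); split=> //; first exact: openI.
  move=> q i j [Nq Wq] di dj v; apply: etrans (esym (EW q i Wq di v)) _.
  exact: (is_pullback_Pull (push beta) Nq di dj).
apply: (ideal_germ (I_ideal Np)) _ Ia; exists (N `&` W); split=> //; first exact: openI.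
move=> q i [Nq Wq] di v.
by apply: etrans (is_pullback_Pull alpha Nq di Logic.I v) (esym (E q i tt Wq di Logic.I v)).
Qed.

Lemma st_isomorphism : @MA_isomorphism R m M Rst N U Phi Psi D I (@D_st R n) I_st.
Proof. by split=> //; exact: pulls_back_st. Qed.

(** The description of [I_st] by generators is read back on [M]: here the test ideal [J] lives at
    [p] and is carried to [Phi p] by [ideal_Pull]. *)
Lemma hess_representation : represented_by_hess N (U : set Rst) Phi Psi D I F.
Proof.
split=> //; exists (pull (@theta_st R n)), (pull (hesse_form F)); split.
- exact: is_pullback_Pull.
- exact: is_pullback_Pull.
move=> p Np k alpha; have Up := PhiU Np; have EP := PhiK Np.
have Ip := I_ideal Np.
have It : I p (pull (@theta_st R n)) by have := I_st_theta Up; rewrite /I_st EP.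
have Ih : I p (pull (hesse_form F)) by have := I_st_hesse Up; rewrite /I_st EP.
split=> [Ia J JI Jt Jdt Jh|]; last first.
  by apply=> //; exact: (eds_extd I_EDS Np It).
have JI' := ideal_Pull Ndom dPhi Np JI.
have Fa := ideal_form Ip Ia.
have PP := Pull_Push Ndom dPhi Np Fa.
apply: (ideal_germ JI) PP _.
have Ia' : I_st (Phi p) (push alpha) by apply: I_st_push => //; rewrite EP.
apply: ((I_st_generated Up _).1 Ia' _ JI') => //.
apply: (ideal_germ JI) _ Jdt; apply: (Pull_extd dPhi Np).
by exists U; split=> //; exact: theta_st_form.
Qed.

End Representation.

(** * Restriction to smaller open sets and conclusion *)

Lemma pushes_to_sub (R : realType) m (M M' : manifold R m) (N N0 : set M) (Phi : M -> M')
    (E : plane_field M) (E' : plane_field M') :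
  N0 `<=` N -> pushes_to N Phi E E' -> pushes_to N0 Phi E E'.
Proof. by move=> sN H p i j /sN; exact: H. Qed.

Lemma bidecomposing_sub (R : realType) m (M : manifold R m) n (N N0 : set M)
    (E1 E2 : plane_field M) (omega1 omega2 : mform M n) :
  N0 `<=` N -> bidecomposing N E1 E2 omega1 omega2 -> bidecomposing N0 E1 E2 omega1 omega2.
Proof.
move=> sN [[F1 F2] omega1_E2 omega2_E1 omega1_vol omega2_vol]; split.
- by split; [exact: sub_is_form F1|exact: sub_is_form F2].
- by move=> p i /sN; exact: omega1_E2.
- by move=> p i /sN; exact: omega2_E1.
- by move=> p i /sN; exact: omega1_vol.
- by move=> p i /sN; exact: omega2_vol.
Qed.

Lemma contact_form_sub (R : realType) m (M : manifold R m) (N N0 : set M)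
    (D : plane_field M) (theta : mform M 1) :
  N0 `<=` N -> contact_form N D theta -> contact_form N0 D theta.
Proof.
move=> sN [Ft Ht]; split; first exact: sub_is_form Ft.
by move=> p i /sN; exact: Ht.
Qed.

Lemma EDS_sub (R : realType) m (M : manifold R m) (N N0 : set M) (I : form_sheaf M) :
  N0 `<=` N -> is_EDS N I -> is_EDS N0 I.
Proof.
by move=> sN [H1 H2 H3]; split=> [p /sN|p k alpha /sN|p k alpha /sN];
  [exact: H1|exact: H2|exact: H3].
Qed.

Theorem proposition6p6 (R : realType) (n : nat) (M : manifold R (dim2n1 n))
    (D E1 E2 : plane_field M) (I : form_sheaf M)
    (hM : hesse_MA_system D E1 E2 I) :
  (forall p : M, exists (N : set M) (U : set (euclid R (dim2n1 n)))
      (Phi : M -> euclid R (dim2n1 n)) (Psi : euclid R (dim2n1 n) -> M)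
      (I' : form_sheaf (euclid R (dim2n1 n))) (F : 'rV[R]_(dim2n1 n) -> R),
    [/\ N p,
        MA_isomorphism N U Phi Psi D I (@D_st R n) I',
        MA_system_with_pair n U (@D_st R n) (@E1_st R n) (@E2_st R n) I',
        smooth_on U (F : 'rV[R]_(dim2n1 n) -> R^o) /\
          (forall y, U y -> F y != 0)
      & local_generator U (@D_st R n) I' (hesse_form F)]) /\
  (forall p : M, exists (N : set M) (U : set (euclid R (dim2n1 n)))
      (Phi : M -> euclid R (dim2n1 n)) (Psi : euclid R (dim2n1 n) -> M)
      (F : 'rV[R]_(dim2n1 n) -> R),
    [/\ N p,
        smooth_on U (F : 'rV[R]_(dim2n1 n) -> R^o),
        forall y, U y -> F y != 0
      & represented_by_hess N U Phi Psi D I F]).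
Proof.
case: hM => -[[_ I_EDS _] _ HW] Hflat.
(* One choice of coordinates and of [F] serves both conclusions. *)
suff key p : exists (N : set M) (U : set (euclid R (dim2n1 n)))
      (Phi : M -> euclid R (dim2n1 n)) (Psi : euclid R (dim2n1 n) -> M)
      (I' : form_sheaf (euclid R (dim2n1 n))) (F : 'rV[R]_(dim2n1 n) -> R),
    [/\ N p,
        MA_isomorphism N U Phi Psi D I (@D_st R n) I',
        MA_system_with_pair n U (@D_st R n) (@E1_st R n) (@E2_st R n) I',
        smooth_on U (F : 'rV[R]_(dim2n1 n) -> R^o) /\
          (forall y, U y -> F y != 0)
      & local_generator U (@D_st R n) I' (hesse_form F) /\
        represented_by_hess N U Phi Psi D I F].
  split=> p; have [N [U [Phi [Psi [I' [F [Np iso MA [sF F0] [gen rep]]]]]]]] := key p.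
    by exists N, U, Phi, Psi, I', F.
  by exists N, U, Phi, Psi, F.
have [W [omega1 [omega2 [oW Wp _ bi [_ [theta [ct gen]]]]]]] := HW p Logic.I.
have [N' [U' [Phi [Psi [N'p dPhi' pD' pE1' pE2']]]]] := Hflat p.
have [i0 dp] := dom_cover p.
(* The flat coordinates are cut down to where the bi-decomposed generator is defined and where the
   single chart [i0] is available. *)
pose B := W `&` dom i0.
have oB : open B by apply: openI => //; exact: dom_open.
have dPhi := diffeo_restrict dPhi' oB.
have NN' : N' `&` B `<=` N' by move=> q [].
have NW : N' `&` B `<=` W by move=> q [_ []].
have Ndom : N' `&` B `<=` dom i0 by move=> q [_ []].
have pD := pushes_to_sub NN' pD'.
have pE1 := pushes_to_sub NN' pE1'.
have pE2 := pushes_to_sub NN' pE2'.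
have IN : is_EDS (N' `&` B) I by exact: EDS_sub I_EDS.
have biN := bidecomposing_sub NW bi.
have ctN := contact_form_sub NW ct.
have genN q : (N' `&` B) q -> forall k (alpha : mform M k),
    I q k alpha <-> generated theta (subf omega1 omega2) q alpha.
  by move=> /NW; exact: gen.
exists (N' `&` B), (U' `&` Psi @^-1` B), Phi, Psi, (I_st Phi Psi I),
  (hesse_coef (Push Psi i0 omega1) (Push Psi i0 omega2)).
split.
- by split.
- exact: (st_isomorphism Ndom dPhi pD IN).
- exact: (st_MA_system Ndom dPhi pD pE1 pE2 IN biN ctN genN).
- split; first exact: (hesse_coef_push_smooth Ndom dPhi pE2 biN).
  exact: (hesse_coef_push_neq0 Ndom dPhi pE1 pE2 biN).
- split; first exact: (st_local_generator Ndom dPhi pD pE1 pE2 IN biN ctN genN).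
  exact: (hess_representation Ndom dPhi pD pE1 pE2 IN biN ctN genN).
Qed.
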